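(* Let $1\le k\le n$, write $x=(x',x'')\in\mathbb{R}^k\times\mathbb{R}^{n-k}$, let $1<p<\infty$ and $\alpha\in\mathbb{R}$. (i) For all complex-valued $f\in C_0^\infty(\mathbb{R}^n\setminus\{x'=0\})$, $$\left|\frac{k-\alpha}{p}\right|^p\int_{\mathbb{R}^n}\frac{|f(x)|^p}{|x'|_k^{\alpha}}\,dx\;\le\;\int_{\mathbb{R}^n}\frac{|x'\cdot\nabla_k f(x)|^p}{|x'|_k^{\alpha}}\,dx .$$ Moreover, if $\alpha\neq k$ the constant $\left|\frac{k-\alpha}{p}\right|^p$ is sharp: for every $C>\left|\frac{k-\alpha}{p}\right|^p$ there exists such an $f$ with $C\int_{\mathbb{R}^n}|f|^p|x'|_k^{-\alpha}dx>\int_{\mathbb{R}^n}|x'\cdot\nabla_k f|^p|x'|_k^{-\alpha}dx$. (ii) For all complex-valued $f\in C_0^\infty(\mathbb{R}^n\setminus\{x'=0\})$ the identity $$\left|\frac{k-\alpha}{p}\right|^p\left\|\frac{f}{|x'|_k^{\alpha/p}}\right\|_{L^p(\mathbb{R}^n)}^p=\left\|\frac{x'\cdot\nabla_k f}{|x'|_k^{\alpha/p}}\right\|_{L^p(\mathbb{R}^n)}^p-\int_{\mathbb{R}^n}C_p\!\left(\frac{x'\cdot\nabla_k f}{|x'|_k^{\alpha/p}},\;\frac{x'\cdot\nabla_k f}{|x'|_k^{\alpha/p}}+\frac{k-\alpha}{p}\frac{f}{|x'|_k^{\alpha/p}}\right)dx$$ holds. (iii) If $p\ge 2$, then for every nonzero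 such $f$ the integral of $C_p$ in (ii) is strictly positive (it vanishes only if $f=|x'|_k^{-(k-\alpha)/p}\varphi(x'/|x'|_k,x'')$ for some function $\varphi$, which for $f\in C_0^\infty(\mathbb{R}^n\setminus\{x'=0\})$ forces $f=0$); consequently the inequality in (i) is strict for every nonzero $f$, i.e. the sharp constant is not attained in $C_0^\infty(\mathbb{R}^n\setminus\{x'=0\})$.
   Context: $|\cdot|_k$ denotes the Euclidean norm on $\mathbb{R}^k$, $\nabla_k=(\partial_{x_1},\dots,\partial_{x_k})$ is the gradient in the $x'$ variables, and $x'\cdot\nabla_k f=\sum_{j=1}^k x_j\partial_{x_j}f$. For complex numbers $\xi,\eta$ and $1<p<\infty$, $$C_p(\xi,\eta):=|\xi|^p-|\xi-\eta|^p-p|\xi-\eta|^{p-2}\operatorname{Re}\big((\xi-\eta)\overline{\eta}\big),$$ with the last term interpreted as $0$ when $\xi=\eta$. *)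

(* Defs.v *)
From HB Require Import structures.
From mathcomp Require Import all_boot all_order all_algebra.
From mathcomp Require Import all_classical all_reals all_analysis.
From mathcomp.real_closed Require Export complex.

Set Implicit Arguments.
Unset Strict Implicit.
Unset Printing Implicit Defensive.

Import Order.TTheory GRing.Theory Num.Theory.
Import numFieldNormedType.Exports.

Local Open Scope classical_set_scope.
Local Open Scope ring_scope.

Section Defs.
Variable R : realType.

Definition xnorm (k n : nat) (x : 'rV[R]_n) : R :=
  Num.sqrt (\sum_(j < n | (j < k)%N) x 0 j ^+ 2).

Fixpoint iter_pder (n : nat) (s : seq 'I_n) (u : 'rV[R]_n -> R)
    : 'rV[R]_n -> R :=
  match s with
  | [::] => u
  | j :: s' => fun x => derive (iter_pder s' u) x 'e_j
  end.

Definition smoothR (n : nat) (u : 'rV[R]_n -> R) : Prop :=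
  forall s : seq 'I_n, continuous (iter_pder s u) /\
    (forall (j : 'I_n) (x : 'rV[R]_n), derivable (iter_pder s u) x 'e_j).

Definition smoothC (n : nat) (f : 'rV[R]_n -> R[i]) : Prop :=
  smoothR (fun x => complex.Re (f x)) /\ smoothR (fun x => complex.Im (f x)).

Definition supp_off_axis (k n : nat) (f : 'rV[R]_n -> R[i]) : Prop :=
  exists K : set 'rV[R]_n, [/\ compact K,
    (forall x, K x -> xnorm k x != 0) &
    (forall x, ~ K x -> f x = 0)].

Definition test_fun (k n : nat) (f : 'rV[R]_n -> R[i]) : Prop :=
  smoothC f /\ supp_off_axis k f.

Definition pderC (n : nat) (j : 'I_n) (f : 'rV[R]_n -> R[i]) (x : 'rV[R]_n)
    : R[i] :=
  Complex (derive (fun y => complex.Re (f y)) x 'e_j)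
          (derive (fun y => complex.Im (f y)) x 'e_j).

Definition radial_der (k n : nat) (f : 'rV[R]_n -> R[i]) (x : 'rV[R]_n)
    : R[i] :=
  \sum_(j < n | (j < k)%N) (Complex (x 0 j) 0) * pderC j f x.

(* Lebesgue integral over R^n, computed as the iterated integral of the
   one-dimensional Lebesgue integrals (first coordinate outermost). *)
Fixpoint iter_integral (m : nat) (F : seq R -> \bar R) : \bar R :=
  match m with
  | 0 => F [::]
  | m'.+1 => (\int[lebesgue_measure]_(t in [set: R])
                 iter_integral m' (fun s => F (t :: s)))%E
  end.

Definition integral_Rn (n : nat) (F : 'rV[R]_n -> \bar R) : \bar R :=
  iter_integral n (fun s => F (\row_(i < n) nth 0 s i)).

Definition cabs (z : R[i]) : R :=
  Num.sqrt (complex.Re z ^+ 2 + complex.Im z ^+ 2).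

Definition Cp (p : R) (xi eta : R[i]) : R :=
  let z := xi - eta in
  cabs xi `^ p - cabs z `^ p -
  (if z == 0 then 0 else p * cabs z `^ (p - 1 - 1) * complex.Re (z * conjc eta)).

End Defs.

(* Main.v *)
(** Write g for the radial derivative x'.grad_k f and a = (k - alpha) / p.
    Every integrand is continuous with compact support, so the iterated
    integral is linear, monotone, strictly positive and obeys the scaling law
    of each coordinate. Differentiating that scaling law at 1 for
    F = |f|^p |x'|^-b gives
      p int |f|^(p-2) Re(f conj g) |x'|^-b = (b - k) int |f|^p |x'|^-b,
    which for b = alpha is identity (ii) once C_p is expanded. By strict
    convexity of |.|^p, C_p >= 0 with equality only if its second argument
    vanishes. If the remainder vanished then g = - a f everywhere, and the
    displayed identity for an exponent b <> alpha would give f = 0.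

    For sharpness take f = |x'|^-a X(ln |x'|) cutoff(x''), with X a bump
    stretched to length 3N. Since |x'|^-k dx' is dilation invariant, both
    integrals become translation invariant functionals of functions of
    ln |x'|; comparison with trapezoids shows that the contribution of X' is
    bounded while the integral of |f|^p |x'|^-alpha grows linearly in N. *)
Require Import Defs.
From HB Require Import structures.
From mathcomp Require Import all_boot all_order all_algebra.
From mathcomp Require Import all_classical all_reals all_analysis.
From mathcomp.real_closed Require Import complex.
From mathcomp Require Import ring lra.
Import Order.TTheory GRing.Theory Num.Theory.
Import numFieldNormedType.Exports.
Local Open Scope classical_set_scope.
Local Open Scope ring_scope.
Set Implicit Arguments.
Unset Strict Implicit.
Unset Printing Implicit Defensive.

(** * Integrals of compactly supported continuous functions *)

Section pointwise_continuity.
Variables (R : realType) (T : topologicalType) (x : T).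
Implicit Types (u v : T -> R).

(** The integral is iterated by definition, so its properties are proved by induction on the
    coordinates, and the only change of variables is the one-dimensional t -> c t. That is why
    integration by parts appears as the derivative of a scaling law, obtained from a uniform
    first-order estimate. Similarly, the sharpness argument evaluates no integral: a trapezoid of
    length m is a sum of m translates of a single one, so only the positivity of one number is
    needed.

    The delicate points of the calculus are the zeros of f, where |f|^(p-2) blows up if p < 2. As p
    > 1, |f|^p is still differentiable there, with derivative 0, and the derivative stays
    continuous; this matches the convention in C_p.

    A vanishing remainder is excluded by a mismatch of factors: if g = - a f, then p |f|^(p-2) Re(f
    conj g) is (alpha - k) |f|^p, independently of b, whereas the integral identity has the factor b
    - k. *)

Lemma contD u v : continuous_at x u -> continuous_at x v ->
  continuous_at x (fun y => u y + v y).
Proof. by move=> cu cv; exact: (cvgD cu cv). Qed.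

Lemma contM u v : continuous_at x u -> continuous_at x v ->
  continuous_at x (fun y => u y * v y).
Proof. by move=> cu cv; exact: (cvgM cu cv). Qed.

Lemma cont_cst (a : R) : continuous_at x (fun=> a).
Proof. exact: cvg_cst. Qed.

Lemma cont_comp u (g : R -> R) : continuous_at x u ->
  continuous_at (u x) g -> continuous_at x (fun y => g (u y)).
Proof. by move=> cu cg; exact: (continuous_comp cu cg). Qed.

Lemma cont_ext u v : (forall y, u y = v y) -> continuous_at x u ->
  continuous_at x v.
Proof. by move=> /funext ->. Qed.

Lemma cont_sum (I : Type) (r : seq I) (P : pred I) (u : I -> T -> R) :
  (forall i, P i -> continuous_at x (u i)) ->
  continuous_at x (fun y => \sum_(i <- r | P i) u i y).
Proof.
move=> cu; elim: r => [|i r IH].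
  by apply: (@cont_ext (fun=> 0)); [move=> y; rewrite big_nil | exact: cont_cst].
case: (boolP (P i)) => Pi; last by apply: cont_ext IH => y; rewrite big_cons (negPf Pi).
by apply: cont_ext (contD (cu _ Pi) IH) => y; rewrite big_cons Pi.
Qed.

Lemma cont_near u v : continuous_at x u -> (\near x, u x = v x) ->
  continuous_at x v.
Proof.
move=> cu uv; have e := nbhs_singleton uv.
change (v y @[y --> x] --> v x); rewrite -e.
exact: cvg_trans (near_eq_cvg uv) cu.
Qed.

End pointwise_continuity.

(** * Continuous functions with compact support on the line *)

Section line_integral.
Variable R : realType.
Local Notation mu := (@lebesgue_measure R).
Implicit Types (h : R -> R) (M c t : R).

(** The support radius [M] is a parameter because all slices of an iterated integral have to share
    it. *)
Definition cc1 M h := continuous h /\ (forall t, M < `|t| -> h t = 0).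

Lemma cc1_restrict M h : (forall t, M < `|t| -> h t = 0) ->
  h \_ (`[- M, M]%classic) = h.
Proof.
move=> h0; apply/funext => t; rewrite patchE; case: ifPn => // tM.
apply/esym/h0; rewrite ltNge; apply: contra tM => tM.
by rewrite inE/= in_itv/= -ler_norml.
Qed.

Lemma cc1_integrable M h : cc1 M h -> mu.-integrable setT (EFin \o h).
Proof.
move=> [ch h0]; rewrite -(cc1_restrict h0) -restrict_EFin.
apply/integrable_restrict => //; rewrite setTI.
apply: continuous_compact_integrable; first exact: segment_compact.
exact: continuous_subspaceT.
Qed.

Lemma Rintegral_cc1 M h : cc1 M h ->
  Rintegral mu setT h = Rintegral mu `[- M, M]%classic h.
Proof. by move=> [ch h0]; rewrite [RHS]Rintegral_mkcond cc1_restrict. Qed.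

Lemma cc1_Rintegral_le M (B : R) h : 0 <= M -> cc1 M h -> (forall t, `|h t| <= B) ->
  `|Rintegral mu setT h| <= B * (2 * M).
Proof.
move=> M0 hh hB; rewrite (Rintegral_cc1 hh).
have ih : mu.-integrable `[- M, M]%classic (EFin \o h).
  by apply: (integrableS measurableT) => //; exact: cc1_integrable hh.
apply: le_trans (le_normr_Rintegral _ ih) _ => //.
apply: (@le_trans _ _ (Rintegral mu `[- M, M]%classic (fun=> B))).
  apply: le_Rintegral => //.
  - exact: integrable_norm ih.
  - apply: continuous_compact_integrable; first exact: segment_compact.
    by apply: continuous_subspaceT => x; exact: cst_continuous.
rewrite Rintegral_cst//= lebesgue_measure_itv/= lte_fin.
case: ifPn => [_|]; first by rewrite /= opprK mulrDl mul1r.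
rewrite -leNgt => MM; have -> : M = 0 by lra.
by rewrite /= !mulr0.
Qed.

(** By continuity [h] exceeds half of [h t0] on a closed interval of positive length around [t0]. *)
Lemma cc1_Rintegral_gt0 M h t0 : cc1 M h -> (forall t, 0 <= h t) -> 0 < h t0 ->
  0 < Rintegral mu setT h.
Proof.
move=> hh h0 ht0; have [ch _] := hh.
have /cvgrPdist_lt /(_ (h t0 / 2)) := ch t0.
rewrite divr_gt0// => /(_ isT) /nbhs_ballP[d /= d0 hd].
pose I := `[t0 - d / 2, t0 + d / 2]%classic.
have ih := cc1_integrable hh.
have mI : measurable (I : set (measurableTypeR R)) by exact: measurable_itv.
have iI : mu.-integrable setT (EFin \o ((cst (h t0 / 2)) \_ I)).
  rewrite -restrict_EFin; apply/integrable_restrict; rewrite ?setTI//.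
  apply: continuous_compact_integrable; first exact: segment_compact.
  by apply: continuous_subspaceT => x; exact: cst_continuous.
apply: (@lt_le_trans _ _ (Rintegral mu setT ((cst (h t0 / 2)) \_ I))).
  rewrite -Rintegral_mkcond Rintegral_cst//= lebesgue_measure_itv/= lte_fin ifT; last by lra.
  by rewrite -EFinD /= mulr_gt0//; lra.
apply: le_Rintegral => // t _; rewrite /= /patch; case: ifPn => // tI.
have /= := hd t; rewrite -ball_normE/= => hdt.
have : `|t0 - t| < d.
  by move: tI; rewrite /I inE/= in_itv/= ltr_norml => /andP[? ?]; lra.
by move/hdt; rewrite ltr_norml => /andP[? ?]; lra.
Qed.

Lemma cc1_comp_scale M h c : 0 < c -> cc1 M h ->
  cc1 (M / c) (fun t => h (c * t)).
Proof.
move=> c0 [ch h0]; split.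
  move=> t; apply: (@continuous_comp _ _ _ (fun t => c * t) h); last exact: ch.
  by apply: continuousM; [exact: cst_continuous | exact: cvg_id].
by move=> t; rewrite ltr_pdivrMr// => Mt; apply: h0; rewrite normrM gtr0_norm// mulrC.
Qed.

Lemma cc1_Rintegral_scale M h c : 0 <= M -> 0 < c -> cc1 M h ->
  Rintegral mu setT (fun t => h (c * t)) = c^-1 * Rintegral mu setT h.
Proof.
move=> M0 c0 hh; have hc := cc1_comp_scale c0 hh.
rewrite (Rintegral_cc1 hh) (Rintegral_cc1 hc).
have dE (x : R) : is_derive x (1 : R) (fun t => c * t) c.
  have := @is_deriveZ _ _ _ (id : R -> R) c x 1 1 (is_derive_id _ _).
  by rewrite /GRing.scale/= mulr1.
have dE' : (fun t => c * t)^`()%classic = cst c.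
  by apply/funext => x; rewrite derive1E; have [_ ->] := dE x.
have cE : continuous (fun t => c * t).
  by move=> x; apply: continuousM; [exact: cst_continuous | exact: cvg_id].
have := @integration_by_substitution_increasing R (fun t => c * t) h
  (- (M / c)) (M / c).
rewrite mulrN mulrCA divff ?gt_eqF// mulr1 dE' => H.
have {H} /(congr1 fine) : (\int[mu]_(x in `[(- M)%R, M]) (h x)%:E)%E =
  (\int[mu]_(x in `[(- (M / c))%R, (M / c)%R]) (c * h (c * x))%:E)%E.
  rewrite H.
  - by apply: eq_integral => x _; congr EFin; rewrite mulrC.
  - by rewrite ge0_cp// divr_ge0// ltW.
  - by move=> x y _ _; rewrite ltr_pM2l.
  - by move=> x _; exact: cst_continuous.
  - exact: is_cvg_cst.
  - exact: is_cvg_cst.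
  - split.
    + by move=> x _; have [] := dE x.
    + exact/cvg_at_right_filter/cE.
    + exact/cvg_at_left_filter/cE.
  - by apply: continuous_subspaceT; case: hh.
rewrite -/(Rintegral _ _ _) => ->; rewrite -/(Rintegral mu _ (fun x => c * h (c * x))).
rewrite RintegralZl//; last first.
  by apply: (integrableS measurableT) => //; exact: cc1_integrable hc.
by rewrite mulrA mulVf ?mul1r// gt_eqF.
Qed.

End line_integral.

(** * Iterated integrals of real functions of a list of coordinates *)

Section iterated_integral.
Variable R : realType.
Local Notation mu := (@lebesgue_measure R).
Implicit Types (G H : seq R -> R) (M : R).

(** The real-valued counterpart of [iter_integral]; finiteness is settled once, in
    [iter_integralE]. *)
Fixpoint seq_int (m : nat) G : R :=
  match m with
  | 0 => G [::]
  | m'.+1 => Rintegral mu setT (fun t => seq_int m' (fun s => G (t :: s)))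
  end.

(** The modulus of continuity in the first variable is uniform in the others, which makes the
    integral over the tail a continuous function of [t]. Slices inherit the condition, as induction
    on [m] requires. *)
Fixpoint ccs M (m : nat) G : Prop :=
  match m with
  | 0 => True
  | m'.+1 =>
    [/\ forall t, M < `|t| -> forall s, size s = m' -> G (t :: s) = 0,
        forall t, ccs M m' (fun s => G (t :: s)) &
        forall e : R, 0 < e -> exists2 d : R, 0 < d & forall t t' s, size s = m' ->
          `|t - t'| < d -> `|G (t :: s) - G (t' :: s)| <= e]
  end.

Lemma ccs_cons M m G t : ccs M m.+1 G -> ccs M m (fun s => G (t :: s)).
Proof. by case=> _ /(_ t). Qed.

Lemma eq_seq_int m G H : (forall s, size s = m -> G s = H s) ->
  seq_int m G = seq_int m H.
Proof.
elim: m G H => [|m IH] G H GH /=; first exact: GH.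
by apply: eq_Rintegral => t _; apply: IH => s sm; apply: GH; rewrite /= sm.
Qed.

Lemma ccs_lin M m G H a : ccs M m G -> ccs M m H ->
  ccs M m (fun s => a * G s + H s).
Proof.
elim: m G H => [//|m IH] G H /= [G0 Gc Gu] [H0 Hc Hu]; split.
- by move=> t tM s sm; rewrite G0// H0// mulr0 addr0.
- by move=> t; apply: IH.
- move=> e e0.
  (* The summand 1 permits the division when [a = 0]. *)
  have a1 : 0 < `|a| + 1 by rewrite ltr_wpDl.
  have [d d0 Gd] := Gu (e / 2 / (`|a| + 1)) ltac:(by rewrite !divr_gt0).
  have [d' d'0 Hd] := Hu (e / 2) ltac:(by rewrite !divr_gt0).
  exists (Num.min d d'); first by rewrite lt_min d0.
  move=> t t' s sm; rewrite lt_min => /andP[/(Gd _ _ _ sm) h1 /(Hd _ _ _ sm) h2].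
  have -> : a * G (t :: s) + H (t :: s) - (a * G (t' :: s) + H (t' :: s)) =
    a * (G (t :: s) - G (t' :: s)) + (H (t :: s) - H (t' :: s)) by ring.
  apply: le_trans (ler_normD _ _) _; rewrite normrM.
  have : `|a| * `|G (t :: s) - G (t' :: s)| <= e / 2.
    apply: (@le_trans _ _ ((`|a| + 1) * (e / 2 / (`|a| + 1)))).
      by apply: ler_pM => //; rewrite lerDl.
    by rewrite mulrC divfK// gt_eqF.
  by lra.
Qed.

(** Linearity and the bound go through one induction: together, one level below, they make the tail
    integral continuous, and continuity gives the integrability that linearity requires. *)
Definition seq_int_good M m := forall G H (a B : R), ccs M m G -> ccs M m H ->
  seq_int m (fun s => a * G s + H s) = a * seq_int m G + seq_int m H /\
  ((forall s, size s = m -> `|G s| <= B) -> `|seq_int m G| <= B * (2 * M) ^+ m).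

(** Linearity turns the difference of two tail integrals into the integral of a difference, which
    the bound controls through the modulus in [ccs]. *)
Lemma ccs_cc1_of_good M m G : 0 <= M -> seq_int_good M m -> ccs M m.+1 G ->
  cc1 M (fun t => seq_int m (fun s => G (t :: s))).
Proof.
move=> M0 gm cG; have Gc := fun t => ccs_cons t cG; have [G0 _ Gu] := cG.
have lin := fun G H a hG hH => (gm G H a 0 hG hH).1.
have zero : seq_int m (fun=> 0) = 0.
  elim: (m) => [//|m' IH] /=; under eq_Rintegral do rewrite IH.
  by rewrite Rintegral_cst//= mul0r.
split; last first.
  by move=> t tM; rewrite -zero; apply: eq_seq_int => s sm; exact: G0.
move=> t0; apply/cvgrPdist_le => e e0.
have K0 : 0 < (2 * M) ^+ m + 1 by rewrite ltr_wpDl// exprn_ge0// mulr_ge0.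
have [d d0 hd] := Gu (e / ((2 * M) ^+ m + 1)) ltac:(by rewrite divr_gt0).
apply/nbhs_ballP; exists d => // t /= tt.
have -> : seq_int m (fun s => G (t0 :: s)) - seq_int m (fun s => G (t :: s)) =
   seq_int m (fun s => -1 * G (t :: s) + G (t0 :: s)).
  by rewrite lin//; ring.
have hc : ccs M m (fun s => -1 * G (t :: s) + G (t0 :: s)) by exact: ccs_lin.
have [_ hb] := gm _ _ 0 (e / ((2 * M) ^+ m + 1)) hc hc.
apply: le_trans (hb _) _.
  move=> s sm; rewrite mulN1r addrC; exact: hd.
rewrite mulrAC -mulrA ger_pMr// ler_pdivrMr// mul1r; lra.
Qed.

Lemma seq_int_goodP M m : 0 <= M -> seq_int_good M m.
Proof.
move=> M0; elim: m => [|m IH] G H a B cG cH /=.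
  by split=> // /(_ [::] erefl); rewrite expr0 mulr1.
have iG := ccs_cc1_of_good M0 IH cG; have iH := ccs_cc1_of_good M0 IH cH.
have Gc := fun t => ccs_cons t cG; have Hc := fun t => ccs_cons t cH; split.
  have iaG : mu.-integrable setT
      (EFin \o (fun t => a * seq_int m (fun s => G (t :: s)))).
    by apply: (@integrableZl _ _ _ mu setT measurableT a _ (cc1_integrable iG)).
  rewrite -RintegralZl//; last exact: cc1_integrable iG.
  rewrite -RintegralD//; last exact: cc1_integrable iH.
  by apply: eq_Rintegral => t _; exact: (IH _ _ a 0 (Gc t) (Hc t)).1.
move=> GB; rewrite exprSr mulrA; apply: cc1_Rintegral_le => // t.
by apply: (IH _ _ 0 B (Gc t) (Gc t)).2 => s sm; apply: GB; rewrite /= sm.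
Qed.

Lemma ccs_cc1 M m G : 0 <= M -> ccs M m.+1 G ->
  cc1 M (fun t => seq_int m (fun s => G (t :: s))).
Proof. by move=> M0; apply: ccs_cc1_of_good => //; exact: seq_int_goodP. Qed.

Lemma seq_int_lin M m G H (a : R) : 0 <= M -> ccs M m G -> ccs M m H ->
  seq_int m (fun s => a * G s + H s) = a * seq_int m G + seq_int m H.
Proof. by move=> M0 cG cH; exact: (@seq_int_goodP M m M0 G H a 0 cG cH).1. Qed.

Lemma seq_int_bound M m G (B : R) : 0 <= M -> ccs M m G ->
  (forall s, size s = m -> `|G s| <= B) -> `|seq_int m G| <= B * (2 * M) ^+ m.
Proof. by move=> M0 cG; exact: (@seq_int_goodP M m M0 G G 0 B cG cG).2. Qed.

Lemma seq_int_ge0 m G : (forall s, size s = m -> 0 <= G s) -> 0 <= seq_int m G.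
Proof.
elim: m G => [|m IH] G G0 /=; first exact: G0.
by apply: Rintegral_ge0 => t _; apply: IH => s sm; apply: G0; rewrite /= sm.
Qed.

Lemma seq_int_gt0 M m G s0 : 0 <= M -> ccs M m G ->
  (forall s, size s = m -> 0 <= G s) -> size s0 = m -> 0 < G s0 ->
  0 < seq_int m G.
Proof.
move=> M0; elim: m G s0 => [|m IH] G s0 cG G0 /=; first by move/size0nil ->.
case: s0 => [//|t0 s0] /= [s0m] Gs0; have Gc := fun t => ccs_cons t cG.
apply: (@cc1_Rintegral_gt0 _ M _ t0); first exact: ccs_cc1.
  by move=> t; apply: seq_int_ge0 => s sm; apply: G0; rewrite /= sm.
by apply: (IH _ s0) => // s sm; apply: G0; rewrite /= sm.
Qed.

Lemma iter_integralE M m G : 0 <= M -> ccs M m G ->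
  iter_integral m (fun s => (G s)%:E) = (seq_int m G)%:E.
Proof.
move=> M0; elim: m G => [//|m IH] G cG /=; have Gc := fun t => ccs_cons t cG.
under eq_integral do rewrite IH//.
rewrite /Rintegral fineK//.
exact: (integrable_fin_num measurableT (cc1_integrable (ccs_cc1 M0 cG))).
Qed.

Fixpoint scal (c : nat -> R) (s : seq R) : seq R :=
  if s is t :: s' then c 0%N * t :: scal (c \o S) s' else [::].

Lemma nth_scal c s i : nth 0 (scal c s) i = c i * nth 0 s i.
Proof.
elim: s c i => [|t s IH] c [|i] //=; rewrite ?mulr0//.
by rewrite IH.
Qed.

Lemma seq_int_scale M m G (c : nat -> R) : 0 <= M -> ccs M m G -> (forall i, 0 < c i) ->
  seq_int m (fun s => G (scal c s)) = (\prod_(i < m) c i)^-1 * seq_int m G.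
Proof.
move=> M0; elim: m G c => [|m IH] G c cG c0 /=.
  by rewrite big_ord0 invr1 mul1r.
have Gc := fun t => ccs_cons t cG; have hG := ccs_cc1 M0 cG.
rewrite big_ord_recl/= invfM mulrAC -(cc1_Rintegral_scale M0 (c0 0%N) hG) mulrC.
rewrite -RintegralZl//; last first.
  exact: (cc1_integrable (cc1_comp_scale (c0 0%N) hG)).
by apply: eq_Rintegral => t _; rewrite (IH (fun s => G (c 0%N * t :: s)) (c \o S))// => i; exact: c0.
Qed.

(** Freezing all variables but the first turns a joint modulus of continuity into the recursive
    one. *)
Lemma ccs_unif M m G :
  (forall s, size s = m -> (exists2 i, (i < m)%N & M < `|nth 0 s i|) -> G s = 0) ->
  (forall e : R, 0 < e -> exists2 d : R, 0 < d & forall s s', size s = m ->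
    size s' = m -> (forall i, (i < m)%N -> `|nth 0 s i - nth 0 s' i| < d) ->
    `|G s - G s'| <= e) -> ccs M m G.
Proof.
elim: m G => [//|m IH] G G0 Gu /=; split.
- move=> t tM s sm; apply: G0; first by rewrite /= sm.
  by exists 0%N.
- move=> t; apply: IH.
    move=> s sm [i im iM]; apply: G0; first by rewrite /= sm.
    by exists i.+1.
  move=> e /Gu [d d0 hd]; exists d => // s s' sm s'm ss'.
  apply: hd; rewrite /= ?sm ?s'm// => -[|i] /=; first by rewrite subrr normr0.
  by rewrite ltnS; exact: ss'.
- move=> e /Gu [d d0 hd]; exists d => // t t' s sm tt'.
  by apply: hd; rewrite /= ?sm// => -[|i] //= _; rewrite subrr normr0.
Qed.

End iterated_integral.

(** * Integrals over R^n of continuous functions with compact support *)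

Section Rn_integral.
Variables (R : realType) (n : nat).
Implicit Types (F : 'rV[R]_n -> R) (x y : 'rV[R]_n) (M a : R).

Lemma rV_coord_le x i : `|x 0 i| <= `|x|.
Proof.
by rewrite [leRHS]/Num.Def.normr/= mx_normrE; apply/bigmax_geP; right => /=; exists (ord0, i).
Qed.

Lemma rV_norm_lt x M : 0 < M -> (forall i, `|x 0 i| < M) -> `|x| < M.
Proof.
move=> M0 xM; rewrite [ltLHS]/Num.Def.normr/= mx_normrE; apply/bigmax_ltP; split => //=.
by move=> [i j] _ /=; rewrite ord1.
Qed.

Lemma cont_row (T : topologicalType) (u : T -> 'rV[R]_n) (t : T) :
  (forall i, continuous_at t (fun s => u s 0 i)) -> continuous_at t u.
Proof.
move=> cu; apply/cvgrPdist_lt => e e0.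
have : \forall s \near t, forall i, `|u t 0 i - u s 0 i| < e.
  by apply: filter_forall => i; by have /cvgrPdist_lt := cu i; apply.
by apply: filterS => s h; apply: rV_norm_lt => // i; rewrite !mxE.
Qed.

Definition supp_in M F := forall x, (exists i, M < `|x 0 i|) -> F x = 0.

Definition cc F := continuous F /\ exists2 M, 0 <= M & supp_in M F.

Lemma supp_in_le M M' F : M <= M' -> supp_in M F -> supp_in M' F.
Proof. by move=> MM h x [i xi]; apply: h; exists i; exact: le_lt_trans xi. Qed.

(** Heine-Cantor on a box that exceeds the support by a margin of 1: a point outside it and any
    point within distance 1 are both off the support. *)
Lemma cc_unif F (e : R) : cc F -> 0 < e -> exists2 d : R, 0 < d &
  forall x y, `|x - y| < d -> `|F x - F y| <= e.
Proof.
move=> [cF [M M0 FM]] e0.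
pose K := [set x : 'rV[R]_n | forall i, `[- (M + 1), M + 1]%classic (x 0 i)].
have cK : compact K.
  by apply: (@rV_compact _ _ (fun=> `[- (M + 1), M + 1]%classic)) => _; exact: segment_compact.
(* Compactness makes the radius of continuity, here a parameter [d] tending to 0 from the right,
   independent of the point. *)
have := (compact_near_coveringP K).1 cK R (0^'+)
  (fun d x => forall y, `|x - y| < d -> `|F x - F y| <= e) _.
case.
  move=> x Kx; have /cvgrPdist_lt /(_ (e / 2)) := cF x.
  rewrite divr_gt0// => /(_ isT) /nbhs_ballP[r /= r0 hr].
  exists (ball x (r / 2), [set d | d < r / 2]) => /=.
    split; first by apply: nbhsx_ballx; rewrite divr_gt0.
    by apply: nbhs_right_lt; rewrite divr_gt0.
  move=> [z d] /= [xz dr] y zy.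
  have h1 := hr z; have h2 := hr y.
  have {}xz : `|x - z| < r / 2 by move: xz; rewrite -ball_normE.
  have {}h1 : `|F x - F z| < e / 2.
    by apply: h1; rewrite -ball_normE /=; lra.
  have {}h2 : `|F x - F y| < e / 2.
    apply: h2; rewrite -ball_normE /=.
    have -> : x - y = (x - z) + (z - y) by rewrite addrA subrK.
    by apply: le_lt_trans (ler_normD _ _) _; lra.
  have -> : F z - F y = (F x - F y) - (F x - F z) by ring.
  by apply: le_trans (ler_normB _ _) _; lra.
move=> r /= r0 hr; exists (Num.min (r / 2) 1); first by rewrite lt_min divr_gt0 //=.
move=> x y; rewrite lt_min => /andP[xyr xy1].
have [Kx|/existsNP[i Kx]] := pselect (K x).
  apply: (hr (r / 2)) => //=; last by rewrite divr_gt0.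
  by rewrite sub0r normrN gtr0_norm ?divr_gt0//; lra.
have xi : M + 1 < `|x 0 i|.
  by rewrite ltNge; apply/negP => xi; apply: Kx; rewrite /= in_itv/= -ler_norml.
have yi : M < `|y 0 i|.
  have := rV_coord_le (x - y) i; rewrite !mxE => h.
  have := lerB_dist (x 0 i) (y 0 i); lra.
rewrite FM; last by exists i; lra.
by rewrite FM; [rewrite subrr normr0 ltW|exists i].
Qed.

Definition row_of (s : seq R) : 'rV[R]_n := \row_(i < n) nth 0 s i.

Lemma ccs_row_of M F : 0 <= M -> continuous F -> supp_in M F ->
  ccs M n (fun s => F (row_of s)).
Proof.
move=> M0 cF FM; have ccF : cc F by split => //; exists M.
apply: ccs_unif.
  move=> s sn [i iln Mi]; apply: FM; exists (Ordinal iln).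
  by rewrite mxE.
move=> e e0; have [d d0 hd] := cc_unif ccF e0; exists d => // s s' sn s'n ss'.
by apply: hd; apply: rV_norm_lt => // i; rewrite !mxE; exact: ss'.
Qed.

Definition Rn_int F : R := seq_int n (fun s => F (row_of s)).

Lemma integral_RnE F : cc F -> integral_Rn (fun x => (F x)%:E) = (Rn_int F)%:E.
Proof.
by move=> [cF [M M0 FM]]; apply: (iter_integralE M0); exact: ccs_row_of.
Qed.

Lemma cc_lin a F G : cc F -> cc G -> cc (fun x => a * F x + G x).
Proof.
move=> [cF [M M0 FM]] [cG [M' M'0 GM']]; split.
  move=> x; apply: contD; last exact: cG.
  by apply: contM; [exact: cont_cst | exact: cF].
exists (Num.max M M'); first by rewrite le_max M0.
move=> x [j]; rewrite gt_max => /andP[jM jM'].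
rewrite FM; last by exists j.
by rewrite GM' ?mulr0 ?addr0//; exists j.
Qed.

Lemma Rn_int_lin a F G : cc F -> cc G ->
  Rn_int (fun x => a * F x + G x) = a * Rn_int F + Rn_int G.
Proof.
move=> [cF [M M0 FM]] [cG [M' M'0 GM']].
apply: (@seq_int_lin _ (Num.max M M')); first by rewrite le_max M0.
  apply: ccs_row_of => //; first by rewrite le_max M0.
  by apply: supp_in_le FM; rewrite le_max lexx.
apply: ccs_row_of => //; first by rewrite le_max M0.
by apply: supp_in_le GM'; rewrite le_max lexx orbT.
Qed.

Lemma cc0 : cc (fun=> 0).
Proof. by split; [move=> x; exact: cst_continuous|exists 0]. Qed.

Lemma Rn_int0 : Rn_int (fun=> 0) = 0.
Proof. by have := Rn_int_lin 1 cc0 cc0; under eq_fun do rewrite mulr0 addr0; lra. Qed.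

Lemma Rn_intZ a F : cc F -> Rn_int (fun x => a * F x) = a * Rn_int F.
Proof.
by move=> cF; have := Rn_int_lin a cF cc0; under eq_fun do rewrite addr0; rewrite Rn_int0 addr0.
Qed.

Lemma ccD F G : cc F -> cc G -> cc (fun x => F x + G x).
Proof. by move=> cF cG; have := cc_lin 1 cF cG; under eq_fun do rewrite mul1r. Qed.

Lemma Rn_intD F G : cc F -> cc G -> Rn_int (fun x => F x + G x) = Rn_int F + Rn_int G.
Proof.
by move=> cF cG; have := Rn_int_lin 1 cF cG; under eq_fun do rewrite mul1r; rewrite mul1r.
Qed.

Lemma cc_sum (I : Type) (r : seq I) (P : pred I) (F : I -> 'rV[R]_n -> R) :
  (forall i, P i -> cc (F i)) -> cc (fun x => \sum_(i <- r | P i) F i x) /\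
  Rn_int (fun x => \sum_(i <- r | P i) F i x) = \sum_(i <- r | P i) Rn_int (F i).
Proof.
move=> cF; elim: r => [|i r [IH1 IH2]].
  under eq_fun do rewrite big_nil; rewrite Rn_int0 big_nil; split => //; exact: cc0.
under eq_fun do rewrite big_cons; rewrite big_cons.
case: ifPn => Pi; split=> //; first exact: (ccD (cF _ Pi)).
by rewrite Rn_intD ?IH2//; exact: cF.
Qed.

Lemma Rn_int_ge0 F : (forall x, 0 <= F x) -> 0 <= Rn_int F.
Proof. by move=> F0; apply: seq_int_ge0. Qed.

Lemma Rn_int_le F G : cc F -> cc G -> (forall x, F x <= G x) -> Rn_int F <= Rn_int G.
Proof.
move=> cF cG FG; rewrite -subr_ge0 -(mulN1r (Rn_int F)) addrC -Rn_int_lin//.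
by apply: Rn_int_ge0 => x; have := FG x; lra.
Qed.

Lemma Rn_int_gt0 F x0 : cc F -> (forall x, 0 <= F x) -> 0 < F x0 -> 0 < Rn_int F.
Proof.
move=> [cF [M M0 FM]] F0 Fx0.
pose s0 := [seq x0 0 i | i <- enum 'I_n].
have E : row_of s0 = x0.
  apply/rowP => i; rewrite mxE (nth_map i) ?size_enum_ord//.
  by rewrite nth_ord_enum.
apply: (@seq_int_gt0 _ M _ _ s0) => //; first exact: ccs_row_of.
  by rewrite size_map size_enum_ord.
by rewrite E.
Qed.

Lemma Rn_int_bound M B F : 0 <= M -> continuous F -> supp_in M F ->
  (forall x, `|F x| <= B) -> `|Rn_int F| <= B * (2 * M) ^+ n.
Proof. by move=> M0 cF FM FB; apply: seq_int_bound => //; exact: ccs_row_of. Qed.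

(** One factor per coordinate serves two purposes: stretching a single coordinate, and dilating [x']
    while [x''] stays fixed. *)
Definition dil (c : nat -> R) x : 'rV[R]_n := \row_i (c i * x 0 i).

Lemma dil_cont c : continuous (dil c).
Proof.
move=> x; apply: cont_row => i.
apply: (@cont_ext _ _ _ (fun y : 'rV[R]_n => c i * y 0 i)).
  by move=> y; rewrite mxE.
by apply: contM; [exact: cont_cst|exact: coord_continuous].
Qed.

Lemma Rn_int_dil c F : cc F -> (forall i, 0 < c i) ->
  Rn_int (fun x => F (dil c x)) = (\prod_(i < n) c i)^-1 * Rn_int F.
Proof.
move=> [cF [M M0 FM]] c0.
rewrite -(seq_int_scale M0 _ c0); last exact: ccs_row_of.
apply: eq_seq_int => s _; congr F; apply/rowP => i.
by rewrite !mxE nth_scal.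
Qed.

End Rn_integral.

(** * Derivatives of powers of the modulus *)

Section directional.
Variables (R : realType) (V : normedModType R).
Implicit Types (u : V -> R) (x v : V).

(** Restriction to a line makes one-variable calculus, such as the mean value theorem, available for
    directional derivatives. *)
Lemma is_derive_line u x v (t d : R) :
  is_derive (x + t *: v) v u d <-> is_derive t (1 : R) (fun h => u (x + h *: v)) d.
Proof.
have E : (fun h : R => h^-1 *: ((u \o shift (x + t *: v)) (h *: v) - u (x + t *: v))) =
  (fun h : R => h^-1 *: (((fun h => u (x + h *: v)) \o shift t) (h *: (1 : R)) -
    (fun h => u (x + h *: v)) t)).
  apply/funext => h /=; congr (_ *: (u _ - _)).
  by rewrite /shift /= [h *: 1]mulr1 scalerDl addrCA.
have E1 : derivable u (x + t *: v) v = derivable (fun h : R => u (x + h *: v)) t 1.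
  by rewrite /derivable E.
have E2 : 'D_v u (x + t *: v) = 'D_1 (fun h : R => u (x + h *: v)) t.
  by rewrite /derive E.
by split=> -[d1 d2]; split; [rewrite -E1|rewrite -E2|rewrite E1|rewrite E2].
Qed.

(** The chain rule along a line, so that [u] is only asked to have a derivative in the direction
    [v]. *)
Lemma isd_comp u (g : R -> R) x v (du dg : R) :
  is_derive x v u du -> is_derive (u x) (1 : R) g dg ->
  is_derive x v (fun y => g (u y)) (dg * du).
Proof.
move=> hu hg; have x0 : x + 0 *: v = x by rewrite scale0r addr0.
rewrite -{1}x0; apply/is_derive_line.
apply: (@is_derive1_comp _ g (fun h => u (x + h *: v))); first by rewrite x0.
by apply/is_derive_line; rewrite x0.
Qed.

Lemma isdD u w x v (du dw : R) : is_derive x v u du -> is_derive x v w dw ->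
  is_derive x v (fun y => u y + w y) (du + dw).
Proof. by move=> hu hw; exact: (is_deriveD hu hw). Qed.

Lemma isdM u w x v (du dw : R) : is_derive x v u du -> is_derive x v w dw ->
  is_derive x v (fun y => u y * w y) (du * w x + u x * dw).
Proof.
move=> hu hw; apply: is_derive_eq (is_deriveM hu hw) _.
by rewrite addrC; congr (_ + _); rewrite mulrC.
Qed.

Lemma isd_sum (I : Type) (r : seq I) (P : pred I) (u : I -> V -> R) x v
    (du : I -> R) : (forall i, P i -> is_derive x v (u i) (du i)) ->
  is_derive x v (fun y => \sum_(i <- r | P i) u i y) (\sum_(i <- r | P i) du i).
Proof.
move=> hu; elim: r => [|i r IH].
  have -> : (fun y => \sum_(i <- [::] | P i) u i y) = cst 0.
    by apply/funext => y; rewrite big_nil.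
  by rewrite big_nil; exact: is_derive_cst.
rewrite big_cons.
have -> : (fun y => \sum_(i <- i :: r | P i) u i y) =
    (fun y => if P i then u i y + \sum_(i <- r | P i) u i y else \sum_(i <- r | P i) u i y).
  by apply/funext => y; rewrite big_cons.
by case: ifPn => // Pi; apply: isdD => //; exact: hu.
Qed.

Lemma isd_near0 u x v : (\near x, u x = 0) -> is_derive x v u 0.
Proof.
move=> u0; have h : \near x, cst 0 x = u x by apply: filterS u0 => y ->.
exact: (near_eq_is_derive h (is_derive_cst 0 x v)).
Qed.

Lemma is_derive_cont (g : R -> R) (t d : R) : is_derive t (1 : R) g d ->
  continuous_at t g.
Proof.
move=> [hg _]; apply: differentiable_continuous; exact/derivable1_diffP.
Qed.

End directional.

Section coordinates.
Variables (R : realType) (n : nat).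

Lemma isd_coord (i j : 'I_n) (x : 'rV[R]_n) :
  is_derive x 'e_j (fun y : 'rV[R]_n => y 0 i) ((i == j)%:R).
Proof.
rewrite -[x]addr0 -(scale0r 'e_j); apply/is_derive_line.
have -> : (fun h : R => (x + h *: 'e_j) 0 i) = (fun h => x 0 i + (i == j)%:R * h).
  by apply/funext => h; rewrite !mxE eqxx /= mulrC.
have := isdD (is_derive_cst (x 0 i) (0 : R) (1 : R))
  (isdM (is_derive_cst ((i == j)%:R : R) (0 : R) (1 : R)) (is_derive_id (0 : R) (1 : R))).
by move/is_derive_eq; apply; rewrite mul0r !add0r mulr1.
Qed.

Lemma cont_coord (i : 'I_n) (x : 'rV[R]_n) :
  continuous_at x (fun y : 'rV[R]_n => y 0 i).
Proof. exact: coord_continuous. Qed.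

End coordinates.

Section powers.
Variable R : realType.
Implicit Types (p r : R).

(** Away from 0 the power is differentiable; at 0 the radius e^(1/r) is explicit. *)
Lemma powR_abs_cont r (y : R) : 0 < r -> continuous_at y (fun y : R => `|y| `^ r).
Proof.
move=> r0; have [->|y0] := eqVneq y 0; last first.
  have := @is_derive1_powR R r `|y| ltac:(by rewrite normr_gt0).
  move/is_derive_cont => h; apply: (@cont_comp _ _ _ (fun y => `|y|) (fun y => y `^ r)) => //.
  exact: norm_continuous.
apply/cvgrPdist_lt => e e0; rewrite normr0 powR0 ?gt_eqF//.
apply/nbhs_ballP; exists (e `^ r^-1); first exact: powR_gt0.
move=> z /=; rewrite !sub0r !normrN => ze.
rewrite ger0_norm ?powR_ge0//.
have -> : e = (e `^ r^-1) `^ r by rewrite -powRrM mulVf ?gt_eqF// powRr1// ltW.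
by apply: gt0_ltr_powR => //; rewrite ?nnegrE ?powR_ge0.
Qed.

(** The modulus of a + ib; [cabs (Complex a b)] reduces to it. *)
Definition hypot (a b : R) : R := Num.sqrt (a ^+ 2 + b ^+ 2).

Lemma hypot_ge0 a b : 0 <= hypot a b. Proof. exact: sqrtr_ge0. Qed.

Lemma sqr_hypot a b : hypot a b ^+ 2 = a ^+ 2 + b ^+ 2.
Proof. by rewrite sqr_sqrtr// addr_ge0// sqr_ge0. Qed.

Lemma hypot_eq0 a b : (hypot a b == 0) = (a == 0) && (b == 0).
Proof.
rewrite sqrtr_eq0 le_eqVlt ltNge addr_ge0 ?sqr_ge0//= orbF.
by rewrite paddr_eq0 ?sqr_ge0// !sqrf_eq0.
Qed.

Lemma hypot_ge_norm a b : `|a| <= hypot a b /\ `|b| <= hypot a b.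
Proof.
by rewrite -!sqrtr_sqr /hypot; split; apply: ler_wsqrtr; rewrite ?lerDl ?lerDr sqr_ge0.
Qed.

Lemma hypot_le_norm a b : hypot a b <= `|a| + `|b|.
Proof.
rewrite -(@ler_pXn2r _ 2)// ?nnegrE ?hypot_ge0 ?addr_ge0//.
rewrite sqr_hypot -(real_normK (num_real a)) -(real_normK (num_real b)).
have := normr_ge0 a; have := normr_ge0 b; nra.
Qed.

Lemma hypot_powR p a b : hypot a b `^ p = (a ^+ 2 + b ^+ 2) `^ (p / 2).
Proof. by rewrite /hypot -powR12_sqrt ?addr_ge0 ?sqr_ge0// -powRrM mulrC. Qed.

(* the derivative of [hypot u v `^ p] when [u], [v] have derivatives [du], [dv];
   the zero branch is the value of the limit since [1 < p] *)
Definition dhypot p a b (da db : R) : R :=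
  if hypot a b == 0 then 0 else p * hypot a b `^ (p - 1 - 1) * (a * da + b * db).

(** Cauchy-Schwarz absorbs one modulus, so the positive power p - 1 is left and the bound tends to 0
    at the zeros, even for p < 2. *)
Lemma dhypot_le p a b da db : 1 < p ->
  `|dhypot p a b da db| <= p * hypot a b `^ (p - 1) * (`|da| + `|db|).
Proof.
move=> p1; have p0 : 0 < p by lra.
rewrite /dhypot; case: eqP => [->|/eqP ab0].
  by rewrite normr0 mulr_ge0// ?addr_ge0// mulr_ge0 ?powR_ge0// ltW.
have c0 : 0 < hypot a b by rewrite lt_neqAle eq_sym ab0 hypot_ge0.
rewrite !normrM (gtr0_norm p0) (ger0_norm (powR_ge0 _ _)) -!mulrA.
rewrite ler_pM2l// -(mulr_powRB1 (hypot_ge0 a b) (x := hypot a b) (p := p - 1)); last by lra.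
rewrite [X in _ <= X * _]mulrC -mulrA ler_pM2l ?powR_gt0//.
apply: le_trans (ler_normD _ _) _; rewrite !normrM mulrDr.
by have [h1 h2] := hypot_ge_norm a b; apply: lerD; apply: ler_pM.
Qed.

(** With the weights [x 0 j] the partial derivatives combine into the radial one. *)
Lemma dhypot_lin p a b (I : Type) (r : seq I) (P : pred I) (w da db : I -> R) :
  \sum_(i <- r | P i) w i * dhypot p a b (da i) (db i) =
  dhypot p a b (\sum_(i <- r | P i) w i * da i) (\sum_(i <- r | P i) w i * db i).
Proof.
rewrite /dhypot; case: eqP => _.
  by rewrite big1// => i _; rewrite mulr0.
rewrite 2!mulr_sumr -big_split /= mulr_sumr; apply: eq_bigr => i _; ring.
Qed.

(** Away from a common zero of [u] and [v] this is the chain rule. At a common zero the difference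
    quotient is |(u, v)|^(p-1) times a bounded quotient, and p > 1 sends it to 0. *)
Lemma is_derive_hypot p (u v : R -> R) (t du dv : R) : 1 < p ->
  is_derive t (1 : R) u du -> is_derive t (1 : R) v dv ->
  is_derive t (1 : R) (fun s => hypot (u s) (v s) `^ p) (dhypot p (u t) (v t) du dv).
Proof.
move=> p1 hu hv; have p0 : 0 < p by lra.
rewrite /dhypot; case: eqP => [uv0|/eqP uv0]; last first.
  have q0 : 0 < u t ^+ 2 + v t ^+ 2.
    by rewrite -sqr_hypot exprn_gt0// lt_neqAle eq_sym uv0 hypot_ge0.
  have -> : (fun s => hypot (u s) (v s) `^ p) =
      (fun s => (u s * u s + v s * v s) `^ (p / 2)).
    by apply/funext => s; rewrite hypot_powR !expr2.
  have := isd_comp (isdD (isdM hu hu) (isdM hv hv)) (@is_derive1_powR R (p / 2) _ q0).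
  move/is_derive_eq; apply; rewrite hypot_powR.
  have -> : (p - 1 - 1) / 2 = p / 2 - 1 by lra.
  lra.
have /andP[/eqP u0 /eqP v0] : (u t == 0) && (v t == 0) by rewrite -hypot_eq0 uv0.
have lim : h^-1 *: (((fun s => hypot (u s) (v s) `^ p) \o shift t) (h *: (1 : R)) -
    (fun s => hypot (u s) (v s) `^ p) t) @[h --> (0 : R)^'] --> (0 : R).
  have cu := is_derive_cont hu; have cv := is_derive_cont hv.
  have [/cvg_ex[lu hlu] _] := hu; have [/cvg_ex[lv hlv] _] := hv.
  (* The first factor tends to 0 because [u] and [v] vanish at [t]; the second converges because
     they are differentiable. *)
  pose B (h : R) : R := (`|u (h + t)| + `|v (h + t)|) `^ (p - 1) *
    (`|h^-1 *: ((u \o shift t) (h *: 1) - u t)| +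
     `|h^-1 *: ((v \o shift t) (h *: 1) - v t)|).
  have B0 : B h @[h --> (0 : R)^'] --> (0 : R).
    suff : B h @[h --> (0 : R)^'] --> 0 * (`|lu| + `|lv|) by rewrite mul0r.
    apply: cvgM; last by apply: cvgD; apply: cvg_norm.
    apply: cvg_within_filter.
    have : continuous_at (0 : R)
        (fun h => `| `|u (h + t)| + `|v (h + t)| | `^ (p - 1)).
      apply: (@cont_comp _ _ _ (fun h => `|u (h + t)| + `|v (h + t)|)
        (fun y => `|y| `^ (p - 1))); last by apply: powR_abs_cont; lra.
      have sh : continuous_at (0 : R) (fun h => h + t).
        by apply: contD; [exact: cvg_id|exact: cont_cst].
      apply: contD.
        apply: (@cont_comp _ _ _ (fun h => u (h + t)) (fun y => `|y|)); last exact: norm_continuous.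
        by apply: (@cont_comp _ _ _ (fun h => h + t) u) => //; rewrite add0r.
      apply: (@cont_comp _ _ _ (fun h => v (h + t)) (fun y => `|y|)); last exact: norm_continuous.
      by apply: (@cont_comp _ _ _ (fun h => h + t) v) => //; rewrite add0r.
    rewrite /continuous_at add0r u0 v0 normr0 addr0 normr0 powR0; last by rewrite gt_eqF//; lra.
    by under eq_fun do rewrite ger0_norm ?addr_ge0//.
  apply/norm_cvg0P; apply: (@squeeze_cvgr _ _ _ _ (cst 0) B) => //; last exact: cvg_cst.
  near=> h; rewrite normr_ge0 /=.
  have h0 : h != 0 by near: h; exact: nbhs_dnbhs_neq.
  rewrite /B /= /shift /= [h *: 1]mulr1 u0 v0 !subr0.
  have -> : hypot 0 0 `^ p = 0.
    by rewrite hypot_powR expr0n /= addr0 powR0// gt_eqF// divr_gt0.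
  rewrite subr0 !normrZ -mulrDr mulrCA ler_pM2l ?normr_gt0 ?invr_eq0//.
  set z := hypot _ _; have zle : z <= `|u (h + t)| + `|v (h + t)| by exact: hypot_le_norm.
  have z0 : 0 <= z by exact: hypot_ge0.
  rewrite ger0_norm ?powR_ge0// -(mulr_powRB1 z0 p0) mulrC.
  apply: ler_pM => //; first exact: powR_ge0.
  have p10 : 0 <= p - 1 by lra.
  by apply: (ge0_ler_powR p10); rewrite ?nnegrE// (le_trans z0).
split; first by apply/cvg_ex; exists 0.
exact: cvg_lim lim.
Unshelve. all: by end_near. Qed.

Lemma isd_hypot (V : normedModType R) p (u v : V -> R) x w (du dv : R) : 1 < p ->
  is_derive x w u du -> is_derive x w v dv ->
  is_derive x w (fun y => hypot (u y) (v y) `^ p) (dhypot p (u x) (v x) du dv).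
Proof.
move=> p1; rewrite -[x]addr0 -(scale0r w) => /is_derive_line hu /is_derive_line hv.
by apply/is_derive_line; exact: is_derive_hypot.
Qed.

Lemma cont_hypot (T : topologicalType) p (u v : T -> R) x : 0 < p ->
  continuous_at x u -> continuous_at x v ->
  continuous_at x (fun y => hypot (u y) (v y) `^ p).
Proof.
move=> p0 cu cv; apply: (@cont_ext _ _ _ (fun y => `|u y * u y + v y * v y| `^ (p / 2))).
  by move=> y; rewrite hypot_powR -!expr2 ger0_norm// addr_ge0// sqr_ge0.
apply: (@cont_comp _ _ _ (fun y => u y * u y + v y * v y) (fun y => `|y| `^ (p / 2))).
  by apply: contD; apply: contM.
by apply: powR_abs_cont; rewrite divr_gt0.
Qed.

Lemma cont_dhypot (T : topologicalType) p (u v du dv : T -> R) x : 1 < p ->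
  continuous_at x u -> continuous_at x v ->
  continuous_at x du -> continuous_at x dv ->
  continuous_at x (fun y => dhypot p (u y) (v y) (du y) (dv y)).
Proof.
move=> p1 cu cv cdu cdv.
have cq : continuous_at x (fun y => u y * u y + v y * v y).
  by apply: contD; apply: contM.
have [uv0|uv0] := eqVneq (hypot (u x) (v x)) 0; last first.
  have q0 : 0 < u x * u x + v x * v x.
    by rewrite -!expr2 -sqr_hypot exprn_gt0// lt_neqAle eq_sym uv0 hypot_ge0.
  apply: (@cont_near _ _ _ (fun y => p * (u y * u y + v y * v y) `^ ((p - 1 - 1) / 2)
     * (u y * du y + v y * dv y))).
    apply: contM; last by apply: contD; apply: contM.
    apply: contM; first exact: cont_cst.
    apply: (@cont_comp _ _ _ _ (fun y => y `^ ((p - 1 - 1) / 2)) cq).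
    exact: is_derive_cont (is_derive1_powR _ q0).
  have : \forall y \near x, 0 < u y * u y + v y * v y.
    exact: (cvgr_gt _ cq).
  apply: filterS => y; rewrite -!expr2 -sqr_hypot => h.
  have c0 : hypot (u y) (v y) != 0 by apply: contraTneq h => ->; rewrite expr0n ltxx.
  by rewrite /dhypot (negPf c0) hypot_powR sqr_hypot.
rewrite /continuous_at {2}/dhypot uv0 eqxx.
(* At a zero, [dhypot] is squeezed by the continuous majorant of [dhypot_le], which vanishes
   there. *)
pose B y := p * hypot (u y) (v y) `^ (p - 1) * (`|du y| + `|dv y|).
have cB : continuous_at x B.
  apply: contM; last first.
    by apply: contD; [apply: (@cont_comp _ _ _ du (fun y => `|y|))|
       apply: (@cont_comp _ _ _ dv (fun y => `|y|))] => //; exact: norm_continuous.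
  by apply: contM; [exact: cont_cst|apply: cont_hypot => //; lra].
move: cB; rewrite /continuous_at /B uv0 powR0 ?mulr0 ?mul0r; last by rewrite gt_eqF//; lra.
move=> cB; apply/norm_cvg0P; apply: (@squeeze_cvgr _ _ _ _ (cst 0) B) => //; last exact: cvg_cst.
by near=> y; rewrite normr_ge0 /= /B; exact: dhypot_le.
Unshelve. all: by end_near. Qed.

End powers.

(** * Euler's identity for one coordinate *)

Section euler.
Variables (R : realType) (n : nat).
Implicit Types (F : 'rV[R]_n -> R) (x : 'rV[R]_n).

Definition stretch (j : 'I_n) (c : R) (i : nat) : R := if i == j then c else 1.

Lemma dil_stretch j c x : dil (stretch j c) x = x + ((c - 1) * x 0 j) *: 'e_j.
Proof.
apply/rowP => i; rewrite !mxE /stretch eqxx /=.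
have [->|ij] := eqVneq i j; first by rewrite eqxx mulr1; ring.
by rewrite -val_eqE/= in ij; rewrite (negPf ij) mul1r mulr0 addr0.
Qed.

Lemma prod_stretch j c : \prod_(i < n) stretch j c i = c.
Proof.
rewrite (bigD1 j)//= /stretch eqxx big1 ?mulr1// => i ij.
by rewrite -val_eqE/= in ij; rewrite (negPf ij).
Qed.

Lemma cc_coordM F j : cc F -> cc (fun x => x 0 j * F x).
Proof.
move=> [cF [M M0 FM]]; split.
  by move=> x; apply: contM; [exact: cont_coord|exact: cF].
by exists M => // x /FM ->; rewrite mulr0.
Qed.

(* Differentiate the scaling law of the j-th coordinate at the factor 1. *)
Lemma Rn_int_euler F dF j : cc F -> cc dF -> (forall x, is_derive x 'e_j F (dF x)) ->
  Rn_int (fun x => x 0 j * dF x) = - Rn_int F.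
Proof.
move=> ccF ccdF hF.
have [cF [M1 M10 FM1]] := ccF; have [cdF [M2 M20 dFM2]] := ccdF.
pose M := Num.max M1 M2.
have M0 : 0 <= M by rewrite le_max M10.
have FM : supp_in M F by apply: supp_in_le FM1; rewrite le_max lexx.
have dFM : supp_in M dF by apply: supp_in_le dFM2; rewrite le_max lexx orbT.
have ccD := cc_coordM j ccdF.
set D := fun x => x 0 j * dF x.
pose K := (2 * M) ^+ n.
have K0 : 0 <= K by rewrite exprn_ge0// mulr_ge0.
(* One finite step of size [eta] with an error proportional to [e] replaces the limit of difference
   quotients. *)
suff main : forall e, 0 < e -> `|Rn_int F + Rn_int D| <= e * (K + `|Rn_int F|).
  apply/eqP; rewrite -addr_eq0 addrC -normr_le0.
  have K1 : 0 < K + `|Rn_int F| + 1 by rewrite ltr_wpDl// addr_ge0.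
  apply/ler_addgt0Pr => e e0; rewrite add0r.
  apply: le_trans (main (e / (K + `|Rn_int F| + 1)) _) _; first by rewrite divr_gt0.
  rewrite mulrAC -mulrA ger_pMr// ler_pdivrMr// mul1r; lra.
move=> e e0.
have M1p : 0 < M + 1 by lra.
have [d d0 hd] := cc_unif ccdF (divr_gt0 e0 M1p).
(* The bound by [e] controls the difference between [c^-1] and 1; the bound by [d / (M + 1)] keeps
   points of the box within the modulus of continuity of [dF]. *)
pose eta := Num.min e (d / (M + 1)).
have eta0 : 0 < eta by rewrite lt_min e0 divr_gt0.
have etae : eta <= e by rewrite ge_min lexx.
have etad : eta * M < d.
  have : eta * (M + 1) <= d by rewrite -ler_pdivlMr// ge_min lexx orbT.
  nra.
pose c := 1 + eta.
have c0 : 0 < c by rewrite /c; lra.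
have st0 i : 0 < stretch j c i by rewrite /stretch; case: ifP.
have Fc := Rn_int_dil ccF st0; rewrite prod_stretch in Fc.
(* A factor at least 1 never moves a point into the box, so the box of radius [M] also carries the
   stretched function. *)
have supc t (x : 'rV[R]_n) : 1 <= t -> (exists i, M < `|x 0 i|) ->
    exists i, M < `|(dil (stretch j t) x) 0 i|.
  move=> t1 [l ilM]; exists l; rewrite mxE normrM.
  apply: lt_le_trans ilM _; rewrite ler_peMl// /stretch.
  by case: ifP; rewrite ?normr1// ger0_norm//; lra.
have ccFc : cc (fun x => F (dil (stretch j c) x)).
  split.
    move=> x; apply: (@continuous_comp _ _ _ (dil (stretch j c)) F); first exact: dil_cont.
    exact: cF.
  exists M => // x hx; apply: FM; apply: supc => //; rewrite /c; lra.
(* The first-order Taylor remainder is at most [eta * e] uniformly in [x]: the mean value theorem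
   produces [dF] at an intermediate point, and uniform continuity compares it with [dF x]. *)
have key x : `|F (dil (stretch j c) x) - F x - eta * D x| <= eta * e.
  have [xM|xM] := pselect (exists i, M < `|x 0 i|).
    rewrite (FM _ xM) FM; last by apply: supc => //; rewrite /c; lra.
    by rewrite /D (dFM _ xM) !mulr0 !subr0 normr0 mulr_ge0 ?ltW.
  have xj : `|x 0 j| <= M.
    by rewrite leNgt; apply/negP => h; apply: xM; exists j.
  pose phi t := F (x + ((t - 1) * x 0 j) *: 'e_j).
  have dphi t : is_derive t (1 : R) phi (dF (x + ((t - 1) * x 0 j) *: 'e_j) * x 0 j).
    have h1 := (is_derive_line F x 'e_j ((t - 1) * x 0 j) _).1 (hF _).
    have h2 : is_derive t (1 : R) (fun t => (t - 1) * x 0 j) (x 0 j).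
      have := isdM (isdD (is_derive_id t (1 : R)) (is_derive_cst (- 1 : R) t (1 : R)))
        (is_derive_cst (x 0 j) t (1 : R)).
      by move/is_derive_eq; apply; rewrite mulr0 !addr0 mul1r.
    exact: (isd_comp h2 h1).
  have c1 : 1 < c by rewrite /c; lra.
  have cphi : {within `[1, c], continuous phi}.
    by apply: continuous_subspaceT => t; exact: is_derive_cont (dphi t).
  have [th] := @MVT R phi _ 1 c c1 (fun t _ => dphi t) cphi.
  rewrite in_itv /= => /andP[th1 thc].
  rewrite /phi subrr mul0r scale0r addr0 -dil_stretch => ->.
  have -> : c - 1 = eta by rewrite /c; ring.
  set y := x + _ *: _; rewrite /D.
  have -> : dF y * x 0 j * eta - eta * (x 0 j * dF x) = eta * (x 0 j * (dF y - dF x)) by ring.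
  rewrite !normrM (gtr0_norm eta0) ler_pM2l//.
  have hy : `|dF y - dF x| <= e / (M + 1).
    apply: hd; rewrite /y addrAC subrr add0r normrZ.
    apply: le_lt_trans etad.
    have e1 : `|'e_j : 'rV[R]_n| <= 1.
      rewrite [leLHS]/Num.Def.normr/= mx_normrE; apply/bigmax_leP; split => //= -[i1 i2] _ /=.
      by rewrite !mxE; case: (_ && _); rewrite ?normr1 ?normr0.
    rewrite normrM -[leRHS]mulr1; apply: ler_pM => //.
    apply: ler_pM => //; rewrite ger0_norm; rewrite /c in thc; lra.
  apply: (@le_trans _ _ (M * (e / (M + 1)))); first exact: ler_pM.
  by rewrite mulrCA ger_pMr// ler_pdivrMr// mul1r; lra.
have E1 : Rn_int (fun x => -1 * F x + F (dil (stretch j c) x)) = - Rn_int F + c^-1 * Rn_int F.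
  by rewrite Rn_int_lin// Fc mulN1r.
have cc1 := cc_lin (-1) ccF ccFc.
have E2 : Rn_int (fun x => - eta * D x + (-1 * F x + F (dil (stretch j c) x))) =
   - eta * Rn_int D + (- Rn_int F + c^-1 * Rn_int F) by rewrite Rn_int_lin// E1.
have [ccG _] := cc_lin (- eta) ccD cc1.
have bnd : `|- eta * Rn_int D + (- Rn_int F + c^-1 * Rn_int F)| <= eta * e * K.
  rewrite -E2; apply: Rn_int_bound => //.
    move=> x hx; rewrite /D (dFM _ hx) (FM _ hx) FM ?mulr0 ?addr0//.
    by apply: supc => //; rewrite /c; lra.
  move=> x; have -> : - eta * D x + (-1 * F x + F (dil (stretch j c) x)) =
    F (dil (stretch j c) x) - F x - eta * D x by ring.
  exact: key.
have E3 : - eta * Rn_int D + (- Rn_int F + c^-1 * Rn_int F) = - (eta * (Rn_int D + c^-1 * Rn_int F)).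
  have -> : eta = c - 1 by rewrite /c; ring.
  by field; rewrite gt_eqF.
move: bnd; rewrite E3 normrN normrM gtr0_norm// -mulrA ler_pM2l// => bnd.
(* The estimate carries [c^-1] in front of the integral of [F]; the correction is
   [1 - c^-1 = c^-1 * eta], at most [e]. *)
have -> : Rn_int F + Rn_int D = (Rn_int D + c^-1 * Rn_int F) + (c^-1 * eta) * Rn_int F.
  have -> : eta = c - 1 by rewrite /c; ring.
  by field; rewrite gt_eqF.
apply: le_trans (ler_normD _ _) _; rewrite mulrDr; apply: lerD => //.
rewrite normrM; apply: ler_wpM2r => //.
rewrite ger0_norm; last by rewrite mulr_ge0 ?invr_ge0 ?ltW.
apply: le_trans etae; rewrite mulrC ler_pdivrMr// ler_peMr ?ltW//.
by rewrite /c; lra.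
Qed.

End euler.

(** * Radial integration by parts *)

Section weight.
Variables (R : realType) (k n : nat).
Implicit Types (x : 'rV[R]_n) (b : R).

(** Being a polynomial, the square of |x'| avoids differentiating a root; exponents of |x'| are
    halved accordingly. *)
Definition sqnorm x : R := \sum_(j < n | (j < k)%N) x 0 j ^+ 2.

Lemma sqnorm_ge0 x : 0 <= sqnorm x.
Proof. by apply: sumr_ge0 => i _; exact: sqr_ge0. Qed.

Lemma xnorm_powR x b : xnorm k x `^ b = sqnorm x `^ (b / 2).
Proof. by rewrite /xnorm -powR12_sqrt ?sqnorm_ge0// -powRrM mulrC. Qed.

Lemma xnorm_powRV x b : (xnorm k x `^ b)^-1 = sqnorm x `^ (- (b / 2)).
Proof. by rewrite xnorm_powR powRN. Qed.

Lemma xnorm_eq0 x : (xnorm k x == 0) = (sqnorm x == 0).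
Proof. by rewrite sqrtr_eq0 eq_le sqnorm_ge0 andbT. Qed.

Lemma cont_sqnorm x : continuous_at x sqnorm.
Proof.
apply: cont_sum => i _; apply: (@cont_ext _ _ _ (fun y : 'rV[R]_n => y 0 i * y 0 i)).
  by move=> y; rewrite expr2.
by apply: contM; exact: cont_coord.
Qed.

Lemma cont_sqnorm_powR x b : 0 < sqnorm x -> continuous_at x (fun y => sqnorm y `^ b).
Proof.
move=> q0; apply: (@cont_comp _ _ _ sqnorm (fun y => y `^ b)); first exact: cont_sqnorm.
exact: is_derive_cont (is_derive1_powR b q0).
Qed.

Lemma isd_sqnorm x (j : 'I_n) : (j < k)%N -> is_derive x 'e_j sqnorm (2 * x 0 j).
Proof.
move=> jk; have h : is_derive x 'e_j (fun y : 'rV[R]_n => \sum_(i < n | (i < k)%N) (y 0 i * y 0 i))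
    (\sum_(i < n | (i < k)%N) ((i == j)%:R * x 0 i + x 0 i * (i == j)%:R)).
  by apply: isd_sum => i _; apply: isdM; exact: isd_coord.
have -> : sqnorm = (fun y => \sum_(i < n | (i < k)%N) (y 0 i * y 0 i)).
  by apply/funext => y; apply: eq_bigr => i _; rewrite expr2.
move/is_derive_eq: h; apply.
rewrite (bigD1 j)//= eqxx big1 ?addr0; first by rewrite mul1r mulr1 -mulr2n mulr_natl.
by move=> i /andP[_ /negPf ->]; rewrite mul0r mulr0 addr0.
Qed.

Lemma isd_sqnorm_powR x (j : 'I_n) b : (j < k)%N -> 0 < sqnorm x ->
  is_derive x 'e_j (fun y => sqnorm y `^ b) (b * sqnorm x `^ (b - 1) * (2 * x 0 j)).
Proof. by move=> jk q0; exact: isd_comp (isd_sqnorm x jk) (is_derive1_powR b q0). Qed.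

End weight.

(** * Weighted integrals of f = u + iv with compact support [K] off the axis *)

Section off_axis.
Variables (R : realType) (k n : nat) (p : R).
Hypotheses (kn : (k <= n)%N) (p1 : 1 < p).
Variables (u v : 'rV[R]_n -> R) (du dv : 'I_n -> 'rV[R]_n -> R).
Variable (K : set 'rV[R]_n).
Hypotheses (cu : continuous u) (cv : continuous v).
Hypotheses (cdu : forall j, continuous (du j)) (cdv : forall j, continuous (dv j)).
Hypotheses (hu : forall j x, is_derive x 'e_j u (du j x)).
Hypotheses (hv : forall j x, is_derive x 'e_j v (dv j x)).
Hypotheses (cK : compact K) (Kq : forall x, K x -> sqnorm k x != 0).
Hypotheses (Ku : forall x, ~ K x -> u x = 0) (Kv : forall x, ~ K x -> v x = 0).
Implicit Types (x : 'rV[R]_n) (H : 'rV[R]_n -> R) (b : R).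

Lemma off_near x : ~ K x -> \forall y \near x, ~ K y.
Proof.
move=> Kx; have : open (~` K).
  by apply: closed_openC; apply: compact_closed => //; exact: norm_hausdorff.
by rewrite openE => /(_ x Kx).
Qed.

Lemma off_du (w : 'rV[R]_n -> R) (dw : 'I_n -> 'rV[R]_n -> R) :
  (forall j x, is_derive x 'e_j w (dw j x)) -> (forall x, ~ K x -> w x = 0) ->
  forall j x, ~ K x -> dw j x = 0.
Proof.
move=> hw Kw j x Kx.
have [_ <-] := hw j x.
have h : \near x, w x = 0 by apply: filterS (off_near Kx) => y /Kw.
by have [_ ->] := isd_near0 'e_j h.
Qed.

(** The complement of [K] is open, so [H] is locally zero there, in particular near the axis;
    continuity is only at stake where |x'| > 0. *)
Lemma cc_off H : (forall x, ~ K x -> H x = 0) ->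
  (forall x, 0 < sqnorm k x -> continuous_at x H) -> cc H.
Proof.
move=> KH cH; split.
  move=> x; have [Kx|Kx] := pselect (K x).
    by apply: cH; rewrite lt_neqAle eq_sym Kq// sqnorm_ge0.
  apply: (@cont_near _ _ _ (fun=> 0)); first exact: cont_cst.
  by apply: filterS (off_near Kx) => y /KH.
have /compact_bounded[M0 [_ hM]] := cK.
exists (Num.max 0 (M0 + 1)); first by rewrite le_max lexx.
move=> x [l]; rewrite gt_max => /andP[_ lM]; apply: KH => Kx.
have /= h := hM (M0 + 1) ltac:(by rewrite ltrDl) x Kx.
by move: lM; rewrite ltNge (le_trans (rV_coord_le x l) h).
Qed.

Definition radial_re x := \sum_(j < n | (j < k)%N) x 0 j * du j x.
Definition radial_im x := \sum_(j < n | (j < k)%N) x 0 j * dv j x.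

Lemma cont_radial_re x : continuous_at x radial_re.
Proof. by apply: cont_sum => j _; apply: contM; [exact: cont_coord|exact: cdu]. Qed.

Lemma cont_radial_im x : continuous_at x radial_im.
Proof. by apply: cont_sum => j _; apply: contM; [exact: cont_coord|exact: cdv]. Qed.

Lemma off_radial_re x : ~ K x -> radial_re x = 0.
Proof. by move=> Kx; apply: big1 => j _; rewrite (off_du hu Ku)// mulr0. Qed.

Lemma off_radial_im x : ~ K x -> radial_im x = 0.
Proof. by move=> Kx; apply: big1 => j _; rewrite (off_du hv Kv)// mulr0. Qed.

Let p0 : 0 < p. Proof. exact: lt_trans ltr01 p1. Qed.

Lemma hypot00 : hypot 0 0 = 0 :> R.
Proof. by apply/eqP; rewrite hypot_eq0 eqxx. Qed.

(** With f = u + iv and its radial derivative g, these three are |f|^p, |g|^p and p |f|^(p-2) Re(f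
    conj g), each times |x'|^(-b). *)
Definition wpow b x := hypot (u x) (v x) `^ p * sqnorm k x `^ (- (b / 2)).
Definition wpow_radial b x := hypot (radial_re x) (radial_im x) `^ p * sqnorm k x `^ (- (b / 2)).
Definition wpow_mixed b x := dhypot p (u x) (v x) (radial_re x) (radial_im x) * sqnorm k x `^ (- (b / 2)).

Lemma cc_wpow b : cc (wpow b).
Proof.
apply: cc_off => [x Kx|x q0].
  by rewrite /wpow Ku// Kv// hypot00 powR0 ?mul0r// gt_eqF.
by apply: contM; [by apply: cont_hypot|exact: cont_sqnorm_powR].
Qed.

Lemma cc_wpow_radial b : cc (wpow_radial b).
Proof.
apply: cc_off => [x Kx|x q0].
  by rewrite /wpow_radial off_radial_re// off_radial_im// hypot00 powR0 ?mul0r// gt_eqF.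
apply: contM; last exact: cont_sqnorm_powR.
by apply: cont_hypot => //; [exact: cont_radial_re|exact: cont_radial_im].
Qed.

Lemma cc_wpow_mixed b : cc (wpow_mixed b).
Proof.
apply: cc_off => [x Kx|x q0].
  by rewrite /wpow_mixed Ku// Kv// /dhypot hypot00 eqxx mul0r.
apply: contM; last exact: cont_sqnorm_powR.
by apply: cont_dhypot => //; [exact: cont_radial_re|exact: cont_radial_im].
Qed.

Let dF b (j : 'I_n) x := dhypot p (u x) (v x) (du j x) (dv j x) * sqnorm k x `^ (- (b / 2))
  + hypot (u x) (v x) `^ p * (- (b / 2) * sqnorm k x `^ (- (b / 2) - 1) * (2 * x 0 j)).

Lemma off_dF b j x : ~ K x -> dF b j x = 0.
Proof.
by move=> Kx; rewrite /dF Ku// Kv// /dhypot hypot00 eqxx powR0 ?mul0r ?addr0// gt_eqF.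
Qed.

Lemma cc_dF b j : cc (dF b j).
Proof.
apply: cc_off => [x|x q0]; first exact: off_dF.
apply: contD; apply: contM.
- by apply: cont_dhypot.
- exact: cont_sqnorm_powR.
- by apply: cont_hypot.
- apply: contM; first by apply: contM; [exact: cont_cst|exact: cont_sqnorm_powR].
  by apply: contM; [exact: cont_cst|exact: cont_coord].
Qed.

Lemma isd_wpow b (j : 'I_n) x : (j < k)%N -> is_derive x 'e_j (wpow b) (dF b j x).
Proof.
move=> jk; have [Kx|Kx] := pselect (K x); last first.
  rewrite off_dF//; apply: isd_near0; apply: filterS (off_near Kx) => y Ky.
  by rewrite /wpow Ku// Kv// hypot00 powR0 ?mul0r// gt_eqF.
have q0 : 0 < sqnorm k x by rewrite lt_neqAle eq_sym Kq// sqnorm_ge0.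
exact: isdM (isd_hypot p1 (hu j x) (hv j x)) (isd_sqnorm_powR _ jk q0).
Qed.

(** Euler's identity, summed over the coordinates of [x'], gives the factor [k]; the weight,
    homogeneous of degree [- b], gives [b]. *)
Lemma Rn_int_radial b : Rn_int (wpow_mixed b) = (b - k%:R) * Rn_int (wpow b).
Proof.
have H1 (j : 'I_n) : (j < k)%N -> Rn_int (fun x => x 0 j * dF b j x) = - Rn_int (wpow b).
  by move=> jk; apply: Rn_int_euler => [| |x]; [exact: cc_wpow|exact: cc_dF|exact: isd_wpow].
have ccj (j : 'I_n) : (j < k)%N -> cc (fun x => x 0 j * dF b j x).
  by move=> _; apply: cc_coordM; exact: cc_dF.
have [_] := cc_sum (index_enum 'I_n) ccj.
rewrite (eq_bigr (fun=> - Rn_int (wpow b))) => [|j jk]; last exact: H1.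
rewrite (big_ord_narrow kn) sumr_const card_ord.
have -> : (fun x => \sum_(i < n | (i < k)%N) x 0 i * dF b i x) =
    (fun x => - b * wpow b x + wpow_mixed b x).
  apply/funext => x; rewrite /dF.
  under eq_bigr do rewrite mulrDr mulrA.
  rewrite big_split /= -mulr_suml dhypot_lin -/(radial_re x) -/(radial_im x) -/(wpow_mixed b x) addrC.
  congr (_ + _); rewrite /wpow.
  have [Kx|Kx] := pselect (K x); last first.
    by rewrite Ku// Kv// hypot00 powR0 ?gt_eqF// !mul0r mulr0 big1// => i _; rewrite mul0r mulr0.
  have q0 : 0 < sqnorm k x by rewrite lt_neqAle eq_sym Kq// sqnorm_ge0.
  (* The factor [sqnorm] split off here matches the sum of squares produced by differentiating the
     weight. *)
  have qE : sqnorm k x `^ (- (b / 2)) = sqnorm k x * sqnorm k x `^ (- (b / 2) - 1).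
    set r := - (b / 2); have {1}-> : r = 1 + (r - 1) by ring.
    by rewrite powRD ?(gt_eqF q0) ?implybT// powRr1 ?sqnorm_ge0.
  rewrite qE {2}/sqnorm mulr_suml !mulr_sumr; by apply: eq_bigr => i _; field.
rewrite Rn_int_lin; [|exact: cc_wpow|exact: cc_wpow_mixed].
rewrite mulNrn -mulr_natl => h.
by have : Rn_int (wpow_mixed b) = b * Rn_int (wpow b) - k%:R * Rn_int (wpow b); [lra|move=> ->; ring].
Qed.

End off_axis.

(** * The convexity remainder *)

Section convexity.
Variable R : realType.
Implicit Types (p s t : R).

Lemma powRB2 p t : 0 < t -> t `^ (p - 1 - 1) * t ^+ 2 = t `^ p.
Proof.
move=> t0; rewrite -powR_mulrn ?ltW// -powRD ?(gt_eqF t0) ?implybT//.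
by congr (_ `^ _); ring.
Qed.

(** With L = ln(s/t), division by t^(p-1) s leaves p < e^((p-1)L) + (p-1) e^(-L). Both exponentials
    lie strictly above their tangents at 0, whose weighted sum is p. *)
Lemma young_strict p s t : 1 < p -> 0 <= s -> 0 < t -> s != t ->
  p * t `^ (p - 1) * s < s `^ p + (p - 1) * t `^ p.
Proof.
move=> p1 s0 t0 st; have p0 : 0 < p by lra.
move: s0; rewrite le_eqVlt => /predU1P[<-|s0].
  by rewrite mulr0 powR0 ?gt_eqF// add0r mulr_gt0 ?powR_gt0//; lra.
pose L := ln (s / t).
have st0 : 0 < s / t by rewrite divr_gt0.
have L0 : L != 0.
  rewrite ln_eq0//; apply: contraNneq st => h.
  have -> : s = s / t * t by rewrite divfK ?gt_eqF.
  by rewrite h mul1r.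
have e1 : 1 + (p - 1) * L < expR ((p - 1) * L).
  by apply: expR_gt1Dx; rewrite mulf_neq0// gt_eqF//; lra.
have e2 : 1 - L < expR (- L) by apply: expR_gt1Dx; rewrite oppr_eq0.
have E1 : s `^ p = t `^ (p - 1) * s * expR ((p - 1) * L).
  rewrite -(mulr_powRB1 (ltW s0) p0).
  have -> : s `^ (p - 1) = (s / t) `^ (p - 1) * t `^ (p - 1).
    by rewrite -powRM ?ltW// divfK// gt_eqF.
  by rewrite [(s / t) `^ _]/powR (gt_eqF st0) -/L; ring.
have E2 : t `^ p = t `^ (p - 1) * s * expR (- L).
  rewrite expRN /L lnK ?posrE// -(mulr_powRB1 (ltW t0) p0).
  by field; rewrite !gt_eqF.
rewrite E1 E2; have : 0 < t `^ (p - 1) * s by rewrite mulr_gt0 ?powR_gt0.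
set T := t `^ (p - 1) * s => T0.
have -> : p * t `^ (p - 1) * s = T * p by rewrite /T; ring.
have -> : T * expR ((p - 1) * L) + (p - 1) * (T * expR (- L)) =
  T * (expR ((p - 1) * L) + (p - 1) * expR (- L)) by ring.
rewrite ltr_pM2l//.
have : (p - 1) * (1 - L) < (p - 1) * expR (- L) by rewrite ltr_pM2l//; lra.
lra.
Qed.

Lemma hypot_CS (a b c d : R) : a * c + b * d <= hypot a b * hypot c d.
Proof.
apply: le_trans (ler_norm _) _.
rewrite -(@ler_pXn2r _ 2)// ?nnegrE ?mulr_ge0 ?hypot_ge0//.
rewrite real_normK ?num_real// exprMn !sqr_hypot.
have := sqr_ge0 (a * d - b * c); lra.
Qed.

(** Here g is the gap between |x|^p and its tangent at z. It is the sum of Young's gap for the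
    moduli and a positive multiple of the Cauchy-Schwarz gap; if both vanish, x and z have equal
    length and direction. *)
Lemma convex_gap p (x1 x2 z1 z2 : R) : 1 < p -> hypot z1 z2 != 0 ->
  let g := hypot x1 x2 `^ p + (p - 1) * hypot z1 z2 `^ p
    - p * hypot z1 z2 `^ (p - 1 - 1) * (z1 * x1 + z2 * x2) in
  0 <= g /\ (g = 0 -> x1 = z1 /\ x2 = z2).
Proof.
move=> p1 z0 g; have p0 : 0 < p by lra.
set s := hypot x1 x2 in g *; set t := hypot z1 z2 in g z0 *.
have t0 : 0 < t by rewrite lt_neqAle eq_sym z0 hypot_ge0.
have s0 : 0 <= s by exact: hypot_ge0.
have CS : z1 * x1 + z2 * x2 <= t * s by exact: hypot_CS.
have tE : t `^ (p - 1) = t * t `^ (p - 1 - 1) by rewrite mulr_powRB1 ?ltW//; lra.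
pose T := p * t `^ (p - 1 - 1).
have T0 : 0 < T by rewrite mulr_gt0 ?powR_gt0.
have gE : g = (s `^ p + (p - 1) * t `^ p - p * t `^ (p - 1) * s) +
    T * (t * s - (z1 * x1 + z2 * x2)) by rewrite /g tE /T; ring.
have h2 : 0 <= T * (t * s - (z1 * x1 + z2 * x2)).
  by apply: mulr_ge0; [exact: ltW|rewrite subr_ge0].
have [st|st] := eqVneq s t; last first.
  have h1 := young_strict p1 s0 t0 st.
  have g0 : 0 < g by rewrite gE; lra.
  by split; [exact: ltW|move=> h; rewrite h ltxx in g0].
have h1 : s `^ p + (p - 1) * t `^ p - p * t `^ (p - 1) * s = 0.
  by rewrite st -(mulr_powRB1 (ltW t0) p0); ring.
split; first by rewrite gE h1 add0r.
rewrite gE h1 add0r => /eqP; rewrite mulf_eq0 gt_eqF//= subr_eq0 => /eqP h.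
have hx := sqr_hypot x1 x2; have hz := sqr_hypot z1 z2.
rewrite -/s in hx; rewrite -/t in hz.
have H : (x1 - z1) ^+ 2 + (x2 - z2) ^+ 2 = 0.
  have -> : (x1 - z1) ^+ 2 + (x2 - z2) ^+ 2 =
    (x1 ^+ 2 + x2 ^+ 2) + (z1 ^+ 2 + z2 ^+ 2) - 2 * (z1 * x1 + z2 * x2) by ring.
  by rewrite -hx -hz -h st; ring.
move/eqP: H; rewrite paddr_eq0 ?sqr_ge0// !sqrf_eq0 !subr_eq0.
by move=> /andP[/eqP-> /eqP->].
Qed.

(** [Cp] is the gap between |.|^p at [xi] and its tangent at [xi - eta]. When [xi = eta] the tangent
    is zero and [Cp] is |xi|^p. *)
Lemma Cp_convex p (xi eta : R[i]) : 1 < p ->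
  0 <= Cp p xi eta /\ (Cp p xi eta = 0 -> eta = 0).
Proof.
move=> p1; have p0 : 0 < p by lra.
case: xi eta => [x1 x2] [e1 e2]; rewrite /Cp.
set z := (Complex x1 x2 - Complex e1 e2 : R[i]).
have zE : z = Complex (x1 - e1) (x2 - e2) by [].
have z0E : (z == 0) = (hypot (x1 - e1) (x2 - e2) == 0).
  by rewrite zE eq_complex hypot_eq0.
have -> : cabs (Complex x1 x2) = hypot x1 x2 by [].
have -> : cabs z = hypot (x1 - e1) (x2 - e2) by rewrite zE.
have -> : complex.Re (z * conjc (Complex e1 e2)) =
   (x1 - e1) * e1 + (x2 - e2) * e2 by rewrite zE /=; ring.
rewrite z0E; case: eqP => [h|/eqP h].
  rewrite h powR0 ?gt_eqF// !subr0; split; first exact: powR_ge0.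
  move/eqP; rewrite powR_eq0 (gt_eqF p0) andbT hypot_eq0 => /andP[/eqP x10 /eqP x20].
  move/eqP: h; rewrite hypot_eq0 x10 x20 !sub0r !oppr_eq0 => /andP[/eqP-> /eqP->].
  by [].
have [g0 gE] := convex_gap x1 x2 p1 h.
have c0 : 0 < hypot (x1 - e1) (x2 - e2) by rewrite lt_neqAle eq_sym h hypot_ge0.
pose g := hypot x1 x2 `^ p + (p - 1) * hypot (x1 - e1) (x2 - e2) `^ p
  - p * hypot (x1 - e1) (x2 - e2) `^ (p - 1 - 1) * ((x1 - e1) * x1 + (x2 - e2) * x2).
suff -> : hypot x1 x2 `^ p - hypot (x1 - e1) (x2 - e2) `^ p -
   p * hypot (x1 - e1) (x2 - e2) `^ (p - 1 - 1) * ((x1 - e1) * e1 + (x2 - e2) * e2) = g.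
  split => // /gE[h1 h2].
  have -> : e1 = 0 by lra.
  by have -> : e2 = 0 by lra.
rewrite /g -(powRB2 p c0) sqr_hypot; ring.
Qed.

Lemma hypot_scale (w a b : R) : 0 <= w -> hypot (a * w) (b * w) = w * hypot a b.
Proof.
move=> w0; rewrite /hypot !exprMn -mulrDl sqrtrM ?addr_ge0 ?sqr_ge0//.
by rewrite sqrtr_sqr ger0_norm// mulrC.
Qed.

Lemma complex_real_inv (w : R) : (Complex w 0)^-1 = Complex w^-1 0 :> R[i].
Proof.
apply/eqP; rewrite eq_complex /= expr0n /= addr0 mul0r oppr0 eqxx andbT.
by have [->|w0] := eqVneq w 0; [rewrite invr0 mul0r|apply/eqP; field].
Qed.

Lemma complex_div_real (a b w : R) :
  Complex a b / Complex w 0 = Complex (a / w) (b / w) :> R[i].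
Proof.
rewrite complex_real_inv; apply/eqP; rewrite eq_complex /=.
by apply/andP; split; apply/eqP; ring.
Qed.

(** Here xi = g w and eta = xi + a f w, so the base point xi - eta is - a f w, and Re((xi - eta)
    conj eta) is - a w^2 (Re(f conj g) + a |f|^2). *)
Lemma CpE p (a U V Gr Gi w : R) : 1 < p -> 0 <= w -> (0 < w \/ (U = 0 /\ V = 0)) ->
  let xi := Complex (Gr * w) (Gi * w) : R[i] in
  Cp p xi (xi + Complex a 0 * Complex (U * w) (V * w)) =
  w `^ p * (hypot Gr Gi `^ p - `|a| `^ p * hypot U V `^ p
    + a * `|a| `^ (p - 1 - 1) * dhypot p U V Gr Gi + p * `|a| `^ p * hypot U V `^ p).
Proof.
move=> p1 w0 hw xi; have p0 : 0 < p by lra.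
rewrite /Cp; set eta : R[i] := xi + Complex a 0 * _; set z : R[i] := xi - eta.
have etaE : eta = Complex (Gr * w + a * (U * w)) (Gi * w + a * (V * w)).
  by apply/eqP; rewrite eq_complex /=; apply/andP; split; apply/eqP; ring.
have zE : z = Complex ((- a * U) * w) ((- a * V) * w).
  by apply/eqP; rewrite /z etaE eq_complex /=; apply/andP; split; apply/eqP; ring.
have czE : cabs z = w * (`|a| * hypot U V).
  rewrite zE -[cabs _]/(hypot _ _) hypot_scale//; congr (_ * _).
  by rewrite /hypot !exprMn sqrrN -mulrDr sqrtrM ?sqr_ge0// sqrtr_sqr.
have -> : cabs xi = w * hypot Gr Gi by rewrite -[cabs _]/(hypot _ _) hypot_scale.
have z0E : (z == 0) = (cabs z == 0) by rewrite zE eq_complex -[cabs _]/(hypot _ _) hypot_eq0.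
rewrite z0E czE !powRM ?mulr_ge0 ?hypot_ge0//.
case: eqP => [/eqP|/eqP].
  rewrite !mulf_eq0 => h; rewrite subr0.
  have [a0|a0] := eqVneq a 0.
    rewrite a0 normr0 powR0 ?gt_eqF//; ring.
  have cUV : hypot U V = 0.
    move: h; rewrite normr_eq0 (negPf a0) /= => /orP[/eqP w00|/eqP//].
    case: hw => [|[-> ->]]; first by rewrite w00 ltxx.
    by apply/eqP; rewrite hypot_eq0 eqxx.
  by rewrite /dhypot cUV eqxx powR0 ?gt_eqF//; ring.
rewrite !mulf_eq0 !negb_or normr_eq0 => /and3P[wn0 a0 cUV].
have w1 : 0 < w by rewrite lt_neqAle eq_sym wn0.
have a1 : 0 < `|a| by rewrite normr_gt0.
have c1 : 0 < hypot U V by rewrite lt_neqAle eq_sym cUV hypot_ge0.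
rewrite /dhypot (negPf cUV) zE etaE /=.
rewrite -(powRB2 p w1) -(powRB2 p a1) -(powRB2 p c1) real_normK ?num_real// sqr_hypot.
ring.
Qed.

End convexity.

(** * The identity with remainder and the sign of the remainder *)

Section test_functions.
Variables (R : realType) (k n : nat) (p alpha : R).
Hypotheses (kn : (k <= n)%N) (p1 : 1 < p).
Implicit Types (f : 'rV[R]_n -> R[i]) (x : 'rV[R]_n).
Let a : R := (k%:R - alpha) / p.
Let c : R := `|a| `^ p.
Let lhs f := integral_Rn (fun x => (cabs (f x) `^ p / xnorm k x `^ alpha)%:E).
Let rhs f :=
  integral_Rn (fun x => (cabs (radial_der k f x) `^ p / xnorm k x `^ alpha)%:E).
Let wf f x := f x / Complex (xnorm k x `^ (alpha / p)) 0.
Let wg f x := radial_der k f x / Complex (xnorm k x `^ (alpha / p)) 0.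
Let Cint f :=
  integral_Rn (fun x => (Cp p (wg f x) (wg f x + Complex a 0 * wf f x))%:E).

Lemma smoothR_C1 (u : 'rV[R]_n -> R) : smoothR u ->
  [/\ continuous u, forall j, continuous (fun x => 'D_'e_j u x) &
      forall j x, is_derive x 'e_j u ('D_'e_j u x)].
Proof.
move=> su; have [cu du] := su [::]; split; first exact: cu.
  by move=> j; have [] := su [:: j].
by move=> j x; apply: DeriveDef => //; exact: du.
Qed.

Lemma radial_derE f x : radial_der k f x =
  Complex (radial_re k (fun j y => 'D_'e_j (fun z => complex.Re (f z)) y) x)
          (radial_im k (fun j y => 'D_'e_j (fun z => complex.Im (f z)) y) x).
Proof.
rewrite /radial_der /radial_re /radial_im.
elim/big_rec3 : _ => [//|j z1 z2 z3 _ ->].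
by apply/eqP; rewrite eq_complex /=; apply/andP; split; apply/eqP; ring.
Qed.

(** Weighting before or after taking the modulus gives the same two numbers, which reduces the
    inequalities and the identity to arithmetic in [L], [G] and [c]. *)
Lemma hardy_integrals f : test_fun k f -> exists L G : R,
  [/\ lhs f = L%:E, rhs f = G%:E,
      integral_Rn (fun x => (cabs (wf f x) `^ p)%:E) = L%:E,
      integral_Rn (fun x => (cabs (wg f x) `^ p)%:E) = G%:E &
      [/\ Cint f = (G - c * L)%:E, 0 <= G - c * L &
        (exists x, f x != 0) -> 0 < G - c * L]].
Proof.
move=> [[su sv] [K [cK Kx0 Kf]]]; have p0 : 0 < p by exact: lt_trans ltr01 p1.
pose u x := complex.Re (f x); pose v x := complex.Im (f x).
pose du j x := 'D_'e_j u x; pose dv j x := 'D_'e_j v x.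
have [cu cdu hu] := smoothR_C1 su; have [cv cdv hv] := smoothR_C1 sv.
have Kq x : K x -> sqnorm k x != 0 by move=> /Kx0; rewrite xnorm_eq0.
have Ku x : ~ K x -> u x = 0 by move=> /Kf; rewrite /u => ->.
have Kv x : ~ K x -> v x = 0 by move=> /Kf; rewrite /v => ->.
have fE x : f x = Complex (u x) (v x) by rewrite /u /v; case: (f x).
have gE x : radial_der k f x = Complex (radial_re k du x) (radial_im k dv x) by exact: radial_derE.
pose A b := wpow k p u v b; pose B b := wpow_radial k p du dv b; pose D b := wpow_mixed k p u v du dv b.
have cA b : cc (A b) by exact: (cc_wpow p1 cu cv cK Kq Ku Kv).
have cB b : cc (B b) by exact: (cc_wpow_radial p1 cdu cdv hu hv cK Kq Ku Kv).
have cD b : cc (D b) by exact: (cc_wpow_mixed p1 cu cv cdu cdv cK Kq Ku Kv).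
have rad b : Rn_int (D b) = (b - k%:R) * Rn_int (A b).
  exact: (Rn_int_radial kn p1 cu cv cdu cdv hu hv cK Kq Ku Kv).
pose w x := (xnorm k x `^ (alpha / p))^-1.
have w0 x : 0 <= w x by rewrite invr_ge0 powR_ge0.
have wp x : w x `^ p = sqnorm k x `^ (- (alpha / 2)).
  rewrite /w -powRN -powRrM mulNr divfK ?gt_eqF// xnorm_powR.
  by rewrite mulNr.
have wfE x : wf f x = Complex (u x * w x) (v x * w x) by rewrite /wf fE complex_div_real.
have wgE x : wg f x = Complex (radial_re k du x * w x) (radial_im k dv x * w x).
  by rewrite /wg gE complex_div_real.
exists (Rn_int (A alpha)), (Rn_int (B alpha)).
have e1 : lhs f = (Rn_int (A alpha))%:E.
  rewrite -integral_RnE//; congr integral_Rn; apply/funext => x.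
  by rewrite fE -[cabs _]/(hypot _ _) xnorm_powRV.
have e2 : rhs f = (Rn_int (B alpha))%:E.
  rewrite -integral_RnE//; congr integral_Rn; apply/funext => x.
  by rewrite gE -[cabs _]/(hypot _ _) xnorm_powRV.
have e3 : integral_Rn (fun x => (cabs (wf f x) `^ p)%:E) = (Rn_int (A alpha))%:E.
  rewrite -integral_RnE//; congr integral_Rn; apply/funext => x.
  by rewrite wfE -[cabs _]/(hypot _ _) hypot_scale// powRM ?hypot_ge0// wp mulrC.
have e4 : integral_Rn (fun x => (cabs (wg f x) `^ p)%:E) = (Rn_int (B alpha))%:E.
  rewrite -integral_RnE//; congr integral_Rn; apply/funext => x.
  by rewrite wgE -[cabs _]/(hypot _ _) hypot_scale// powRM ?hypot_ge0// wp mulrC.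
have wpos x : K x -> 0 < w x.
  by move=> Kx; rewrite invr_gt0 powR_gt0// lt_neqAle eq_sym Kx0//= sqrtr_ge0.
pose kap := a * `|a| `^ (p - 1 - 1).
pose P x := Cp p (wg f x) (wg f x + Complex a 0 * wf f x).
have PE x : P x = (p - 1) * c * A alpha x + (kap * D alpha x + B alpha x).
  rewrite /P wgE wfE CpE//; last first.
    by have [Kx|Kx] := pselect (K x); [left; exact: wpos|right; rewrite Ku ?Kv].
  by rewrite wp /A /D /B /wpow /wpow_mixed /wpow_radial -/kap -/c; ring.
have PE' : P = (fun x => (p - 1) * c * A alpha x + (kap * D alpha x + B alpha x)).
  by apply/funext.
have cP : cc P by rewrite PE'; apply: cc_lin => //; exact: cc_lin.
have kapa : kap * a = c.
  rewrite /kap /c; have [->|a0] := eqVneq a 0; first by rewrite mulr0 normr0 powR0// gt_eqF.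
  rewrite -(powRB2 p (_ : 0 < `|a|)) ?normr_gt0// real_normK ?num_real//; ring.
(* The mixed term contributes [kap * (alpha - k) = - p * c], which together with [(p - 1) * c]
   leaves [- c]. *)
have RIP : Rn_int P = Rn_int (B alpha) - c * Rn_int (A alpha).
  rewrite PE' Rn_int_lin//; last exact: cc_lin.
  rewrite Rn_int_lin// rad.
  have -> : alpha - k%:R = - (p * a) by rewrite /a; field; rewrite gt_eqF.
  by rewrite -kapa; ring.
split => //; split; first by rewrite /Cint integral_RnE// RIP.
  by rewrite -RIP; apply: Rn_int_ge0 => x; exact: (Cp_convex _ _ p1).1.
move=> [x0 fx0]; rewrite -RIP lt_neqAle Rn_int_ge0 ?andbT; last first.
  by move=> x; exact: (Cp_convex _ _ p1).1.
apply/negP => /eqP P0.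
have Pz x : P x = 0.
  apply/eqP; rewrite eq_le (Cp_convex _ _ p1).1 andbT leNgt; apply/negP => Px.
  have := Rn_int_gt0 cP (fun x => (Cp_convex _ _ p1).1) Px; by rewrite -P0 ltxx.
have gu x : radial_re k du x = - a * u x /\ radial_im k dv x = - a * v x.
  have [Kx|Kx] := pselect (K x); last first.
    by rewrite (off_radial_re k hu cK Ku)// (off_radial_im k hv cK Kv)// Ku// Kv// mulr0.
  have := (Cp_convex _ _ p1).2 (Pz x); rewrite wgE wfE => /eqP.
  rewrite eq_complex /= => /andP[/eqP h1 /eqP h2].
  have wx := wpos x Kx.
  have h1' : (radial_re k du x + a * u x) * w x = 0 by rewrite -h1; ring.
  have h2' : (radial_im k dv x + a * v x) * w x = 0 by rewrite -h2; ring.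
  move/eqP: h1'; rewrite mulf_eq0 (gt_eqF wx) orbF => /eqP h1'.
  move/eqP: h2'; rewrite mulf_eq0 (gt_eqF wx) orbF => /eqP h2'.
  by split; lra.
(* The radial identity with another exponent is incompatible with g = - a f. *)
have DA : D (alpha + 1) = (fun x => - (a * p) * A (alpha + 1) x).
  apply/funext => x; rewrite /D /A /wpow_mixed /wpow; have [-> ->] := gu x.
  rewrite /dhypot; case: eqP => [->|/eqP h]; first by rewrite powR0 ?gt_eqF//; ring.
  have h0 : 0 < hypot (u x) (v x) by rewrite lt_neqAle eq_sym h hypot_ge0.
  by rewrite -(powRB2 p h0) sqr_hypot; ring.
(* Since [- (a * p)] is [alpha - k], it differs by 1 from the factor [alpha + 1 - k] of the
   identity, so the integral itself is zero. *)
have := rad (alpha + 1); rewrite DA Rn_intZ// => h.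
have A0 : Rn_int (A (alpha + 1)) = 0.
  have e : a * p = k%:R - alpha by rewrite /a divfK// gt_eqF.
  by rewrite e in h; lra.
have Kx : K x0 by apply: contrapT => /Kf h0; rewrite h0 eqxx in fx0.
have q0 : 0 < sqnorm k x0 by rewrite lt_neqAle eq_sym Kq// sqnorm_ge0.
suff : 0 < Rn_int (A (alpha + 1)) by rewrite A0 ltxx.
apply: (@Rn_int_gt0 _ _ _ x0) => // [x|].
  by rewrite /A /wpow mulr_ge0 ?powR_ge0.
rewrite /A /wpow mulr_gt0 ?powR_gt0// lt_neqAle hypot_ge0 andbT eq_sym hypot_eq0.
by move: fx0; rewrite fE eq_complex.
Qed.

End test_functions.

(** * Smooth functions *)

Section smooth_line.
Variable R : realType.
Implicit Types (g h : R -> R) (t : R).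

(* the greatest class of functions closed under differentiation *)
Definition smooth1 g := exists S : (R -> R) -> Prop, S g /\
  forall h, S h -> exists2 h', S h' & forall t, is_derive t (1 : R) h (h' t).

Lemma smooth1_derive g : smooth1 g -> exists2 g', smooth1 g' &
  forall t, is_derive t (1 : R) g (g' t).
Proof.
move=> [S [Sg hS]]; have [g' Sg' hg] := hS _ Sg.
by exists g' => //; exists S.
Qed.

Lemma smooth1_cont g : smooth1 g -> continuous g.
Proof. by move=> /smooth1_derive[g' _ hg] t; exact: is_derive_cont (hg t). Qed.

Lemma smooth1_cst (c : R) : smooth1 (fun=> c).
Proof.
exists (fun h => exists c, h = fun=> c); split; first by exists c.
move=> _ [d ->]; exists (fun=> 0); first by exists 0.
by move=> t; exact: is_derive_cst.
Qed.

Lemma smooth1_expR : smooth1 expR.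
Proof.
exists (fun h => h = expR); split => // _ ->; exists expR => // t.
exact: is_derive_expR.
Qed.

(** The sum, product and chain rules keep this class closed under differentiation, so it can itself
    be the witness in [smooth1]. *)
Inductive smooth_alg : (R -> R) -> Prop :=
  | SmoothBase g of smooth1 g : smooth_alg g
  | SmoothAdd g h of smooth_alg g & smooth_alg h : smooth_alg (fun t => g t + h t)
  | SmoothMul g h of smooth_alg g & smooth_alg h : smooth_alg (fun t => g t * h t)
  | SmoothAff g (c d : R) of smooth_alg g : smooth_alg (fun t => g (c * t + d)).

Lemma isd_aff (c d t : R) : is_derive t (1 : R) (fun t => c * t + d) c.
Proof.
have := isdD (isdM (is_derive_cst c t (1 : R)) (is_derive_id t (1 : R)))
  (is_derive_cst d t (1 : R)).
by move/is_derive_eq; apply; rewrite mul0r add0r addr0 mulr1.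
Qed.

Lemma smooth_alg_smooth g : smooth_alg g -> smooth1 g.
Proof.
move=> ag; exists smooth_alg; split => // {g ag} g; elim => {g}.
- move=> g /smooth1_derive[g' sg' hg]; exists g' => //; exact: SmoothBase.
- move=> g h ag [g' ag' hg] ah [h' ah' hh]; exists (fun t => g' t + h' t).
    exact: SmoothAdd.
  by move=> t; exact: isdD.
- move=> g h ag [g' ag' hg] ah [h' ah' hh].
  exists (fun t => g' t * h t + g t * h' t).
    by apply: SmoothAdd; exact: SmoothMul.
  by move=> t; exact: isdM.
- move=> g c d ag [g' ag' hg]; exists (fun t => g' (c * t + d) * c).
    apply: SmoothMul; first exact: SmoothAff.
    exact/SmoothBase/smooth1_cst.
  by move=> t; exact: isd_comp (isd_aff c d t) (hg _).
Qed.

Lemma smooth1_mul g h : smooth1 g -> smooth1 h -> smooth1 (fun t => g t * h t).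
Proof. by move=> sg sh; apply/smooth_alg_smooth/SmoothMul; exact: SmoothBase. Qed.

Lemma smooth1_aff g (c d : R) : smooth1 g -> smooth1 (fun t => g (c * t + d)).
Proof.
by move=> sg; apply: smooth_alg_smooth; apply: SmoothAff; exact: SmoothBase.
Qed.

Lemma isd_flat g t (C : R) : (forall s, `|g (s + t) - g t| <= C * s ^+ 2) ->
  is_derive t (1 : R) g 0.
Proof.
move=> gC.
have lim : h^-1 *: ((g \o shift t) (h *: (1 : R)) - g t) @[h --> (0 : R)^'] --> (0 : R).
  apply/norm_cvg0P; apply: (@squeeze_cvgr _ _ _ _ (cst 0) (fun h : R => C * `|h|)).
  - near=> h; rewrite normr_ge0 /= /shift /= [h *: 1]mulr1 normrZ normfV.
    have h0 : h != 0 by near: h; exact: nbhs_dnbhs_neq.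
    rewrite mulrC ler_pdivrMr ?normr_gt0// -mulrA -expr2 real_normK ?num_real//.
  - exact: cvg_cst.
  - apply: cvg_within_filter.
    have : continuous_at (0 : R) (fun h : R => C * `|h|).
      apply: contM; first exact: cont_cst.
      exact: norm_continuous.
    by rewrite /continuous_at normr0 mulr0.
split; first by apply/cvg_ex; exists 0.
exact: cvg_lim lim.
Unshelve. all: by end_near. Qed.

(** For [P = 1] this is the classical flat function e^(-1/t); polynomials in 1/t close the family
    under differentiation. *)
Definition flat_exp (P : {poly R}) t : R :=
  if 0 < t then P.[t^-1] * expR (- t^-1) else 0.

(** Each monomial satisfies y^i <= i! e^y. *)
Lemma poly_le_expR (P : {poly R}) : exists2 C : R, 0 <= C &
  forall y, 0 <= y -> `|P.[y]| <= C * expR y.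
Proof.
exists (\sum_(i < size P) `|P`_i| * (i`!)%:R).
  by apply: sumr_ge0 => i _; rewrite mulr_ge0.
move=> y y0; rewrite horner_coef; apply: le_trans (ler_norm_sum _ _ _) _.
rewrite mulr_suml; apply: ler_sum => i _; rewrite normrM -mulrA ler_wpM2l//.
rewrite ger0_norm ?exprn_ge0//.
case: (nat_of_ord i) => [|m].
  by rewrite expr0 fact0 mul1r; have := expR_ge1Dx y; lra.
have f0 : 0 < (m.+1)`!%:R :> R by rewrite ltr0n fact_gt0.
by rewrite -ler_pdivrMl// mulrC; have := expR_ge1Dxn m y0; lra.
Qed.

Lemma isd_flat_exp P t :
  is_derive t (1 : R) (flat_exp P) (flat_exp ((P - P^`()) * 'X^2) t).
Proof.
have [t0|t0|t0] := ltgtP t 0.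
- rewrite {2}/flat_exp ltNge (ltW t0) /=; apply: isd_near0.
  have : \forall s \near t, s < 0 by exact: lt_nbhsl.
  by apply: filterS => s s0; rewrite /flat_exp ltNge (ltW s0).
- have n0 : t != 0 by rewrite gt_eqF.
  have hV : is_derive t (1 : R) (fun s : R => s^-1) (- t ^- 2).
    have := @is_deriveV R id t 1 1 n0 (is_derive_id _ _).
    by move/is_derive_eq; apply; rewrite [_ *: _]mulr1.
  have hP : is_derive t (1 : R) (fun s => P.[s^-1]) (P^`().[t^-1] * - t ^- 2).
    exact: isd_comp hV (is_derive_poly P _).
  have hE : is_derive t (1 : R) (fun s => expR (- s^-1)) (expR (- t^-1) * - (- t ^- 2)).
    exact: isd_comp (is_deriveN hV) (is_derive_expR _).
  have h := isdM hP hE; apply: (near_eq_is_derive _ (is_derive_eq h _)).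
    have : \forall s \near t, 0 < s by exact: lt_nbhsr.
    by apply: filterS => s s0; rewrite /flat_exp s0.
  rewrite /flat_exp t0 hornerM hornerXn hornerD hornerN exprVn; ring.
- rewrite t0 {2}/flat_exp ltxx.
  (* The extra factor X^2 yields a bound C s^2 on [flat_exp P], hence derivative 0 at the origin. *)
  have [C C0 hC] := poly_le_expR ('X^2 * P).
  apply: (@isd_flat _ _ C) => s; rewrite addr0 {2}/flat_exp ltxx subr0 /flat_exp.
  case: ifPn => s0; last by rewrite normr0 mulr_ge0// sqr_ge0.
  have := hC s^-1 ltac:(by rewrite invr_ge0 ltW).
  rewrite hornerM hornerXn normrM exprVn => h.
  rewrite normrM (ger0_norm (expR_ge0 _)) expRN ler_pdivrMr ?expR_gt0//.
  move: h; rewrite ger0_norm; last by rewrite invr_ge0 sqr_ge0.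
  rewrite mulrC ler_pdivrMr ?exprn_gt0//.
  by rewrite mulrAC.
Qed.

Lemma smooth1_flat_exp P : smooth1 (flat_exp P).
Proof.
exists (fun h => exists P, h = flat_exp P); split; first by exists P.
move=> _ [Q ->]; exists (flat_exp ((Q - Q^`()) * 'X^2)); first by exists ((Q - Q^`()) * 'X^2).
by move=> t; exact: isd_flat_exp.
Qed.

Definition bump t : R := flat_exp 1 t * flat_exp 1 (-1 * t + 1).

Lemma smooth1_bump : smooth1 bump.
Proof.
apply: smooth1_mul; first exact: smooth1_flat_exp.
exact/smooth1_aff/smooth1_flat_exp.
Qed.

Lemma flat_exp1_ge0 t : 0 <= flat_exp 1 t.
Proof. by rewrite /flat_exp; case: ifP => // _; rewrite hornerC mul1r expR_ge0. Qed.

Lemma bump_ge0 t : 0 <= bump t.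
Proof. by rewrite mulr_ge0// flat_exp1_ge0. Qed.

Lemma bump_out t : t <= 0 \/ 1 <= t -> bump t = 0.
Proof.
rewrite /bump /flat_exp => -[t0|t1]; first by rewrite ltNge t0 mul0r.
by rewrite [X in _ * (if X then _ else _)]ltNge [X in ~~ X](_ : _ = true) ?mulr0//; lra.
Qed.

(** The exponent 6 is 3 + 3, as both [t] and [1 - t] are at least 1/3. *)
Lemma bump_mid t : 1 / 3 <= t <= 2 / 3 -> expR (- 6) <= bump t.
Proof.
move=> /andP[t1 t2]; rewrite /bump /flat_exp.
have -> : 0 < t by lra.
have -> : 0 < -1 * t + 1 by lra.
rewrite !hornerC !mul1r -expRD ler_expR.
have h1 : t^-1 <= 3 by rewrite -[3]invrK lef_pV2 ?posrE; lra.
have h2 : (-1 * t + 1)^-1 <= 3 by rewrite -[3]invrK lef_pV2 ?posrE; lra.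
lra.
Qed.

Lemma isd_zero_lt g g' (t0 : R) : (forall t, is_derive t (1 : R) g (g' t)) ->
  (forall t, t < t0 -> g t = 0) -> forall t, t < t0 -> g' t = 0.
Proof.
move=> hg g0 t tt0.
have h : \near t, g t = 0.
  have : \forall s \near t, s < t0 by exact: lt_nbhsl.
  by apply: filterS => s /g0.
by have [_ <-] := hg t; have [_ ->] := isd_near0 (1 : R) h.
Qed.

Lemma bump_derive : exists2 b' : R -> R, smooth1 b' &
  [/\ forall t, is_derive t (1 : R) bump (b' t),
      forall t, t < 0 \/ 1 < t -> b' t = 0 &
      exists2 M : R, 0 <= M & forall t, `|b' t| <= M].
Proof.
have [b' sb' hb] := smooth1_derive smooth1_bump; exists b' => //.
have out t : t < 0 \/ 1 < t -> b' t = 0.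
  move=> tt; have h : \near t, bump t = 0.
    case: tt => tt.
      have : \forall s \near t, s < 0 by exact: lt_nbhsl.
      by apply: filterS => s s0; apply: bump_out; left; exact: ltW.
    have : \forall s \near t, 1 < s by exact: lt_nbhsr.
    by apply: filterS => s s0; apply: bump_out; right; exact: ltW.
  by have [_ <-] := hb t; have [_ ->] := isd_near0 (1 : R) h.
split => //.
have cb : {within `[0, 1], continuous (fun t => `|b' t|)}.
  apply: continuous_subspaceT => t.
  apply: (@cont_comp _ _ _ b' (fun y => `|y|)); first exact: smooth1_cont.
  exact: norm_continuous.
have [m _ hm] := EVT_max (@ler01 R) cb.
exists `|b' m| => // t.
have [t0|t0] := ltP t 0; first by rewrite out ?normr0//; left.
have [t1|t1] := ltP 1 t; first by rewrite out ?normr0//; right.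
by apply: hm; rewrite in_itv /= t0.
Qed.

(** The threshold [d] is positive because [ln r] is 0 for [r <= 0], and this default must fall where
    [g] vanishes. Then [g (ln r)] is zero for all r < e^d, negative ones included. *)
Definition vanish_near0 g := exists2 d : R, 0 < d & forall s, s < d -> g s = 0.

Lemma isd_comp_ln g g' r : (forall t, is_derive t (1 : R) g (g' t)) ->
  vanish_near0 g -> is_derive r (1 : R) (fun r => g (ln r)) (g' (ln r) * expR (- ln r)).
Proof.
move=> hg [d d0 gd]; have [r0|r0] := ltP 0 r.
  have := isd_comp (is_derive1_ln r0) (hg (ln r)).
  by move/is_derive_eq; apply; rewrite expRN lnK.
have lr : ln r <= 0 by apply: ln_le0; lra.
rewrite (isd_zero_lt hg gd) ?mul0r; last exact: le_lt_trans d0.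
apply: isd_near0; have : \forall s \near r, s < 1 by apply: lt_nbhsl; lra.
by apply: filterS => s s1; apply: gd; apply: le_lt_trans d0; apply: ln_le0; exact: ltW.
Qed.

(** Writing 1/r as e^(-ln r) exhibits the derivative as a composition of the same kind, so these
    compositions are closed under differentiation. *)
Lemma smooth1_comp_ln g : smooth1 g -> vanish_near0 g -> smooth1 (fun r => g (ln r)).
Proof.
move=> sg vg.
exists (fun h => exists2 g, smooth1 g /\ vanish_near0 g & h = (fun r => g (ln r))).
split; first by exists g.
move=> _ [{sg vg}g [sg vg] ->].
have [g' sg' hg] := smooth1_derive sg.
exists (fun r => g' (ln r) * expR (- ln r)); last by move=> t; exact: isd_comp_ln.
exists (fun s => g' s * expR (-1 * s + 0)).
  split; first exact: smooth1_mul sg' (smooth1_aff _ _ smooth1_expR).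
  have [d d0 gd] := vg; exists d => // s sd.
  by rewrite (isd_zero_lt hg gd)// mul0r.
by apply/funext => r; rewrite mulN1r addr0.
Qed.

End smooth_line.

(** * Smooth functions of several variables *)

Section smooth_space.
Variables (R : realType) (n : nat).
Implicit Types (u w : 'rV[R]_n -> R).

(** Closed under every partial derivative and made of continuous functions, hence contained in
    [smoothR]. *)
Inductive smooth_gen : ('rV[R]_n -> R) -> Prop :=
  | GenCst (c : R) : smooth_gen (fun=> c)
  | GenCoord i : smooth_gen (fun x => x 0 i)
  | GenAdd u w of smooth_gen u & smooth_gen w : smooth_gen (fun x => u x + w x)
  | GenMul u w of smooth_gen u & smooth_gen w : smooth_gen (fun x => u x * w x)
  | GenComp g u of smooth1 g & smooth_gen u : smooth_gen (fun x => g (u x)).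

Lemma smooth_gen_cont u : smooth_gen u -> continuous u.
Proof.
elim => {u}.
- by move=> c x; exact: cont_cst.
- by move=> i x; exact: cont_coord.
- by move=> u w _ cu _ cw x; exact: contD.
- by move=> u w _ cu _ cw x; exact: contM.
- by move=> g u sg _ cu x; apply: cont_comp => //; exact: smooth1_cont.
Qed.

Lemma smooth_gen_derive u (j : 'I_n) : smooth_gen u -> exists2 u', smooth_gen u' &
  forall x, is_derive x 'e_j u (u' x).
Proof.
elim => {u}.
- by move=> c; exists (fun=> 0); [exact: GenCst|move=> x; exact: is_derive_cst].
- by move=> i; exists (fun=> (i == j)%:R); [exact: GenCst|move=> x; exact: isd_coord].
- move=> u w _ [u' gu' hu] _ [w' gw' hw]; exists (fun x => u' x + w' x).
    exact: GenAdd.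
  by move=> x; exact: isdD.
- move=> u w gu [u' gu' hu] gw [w' gw' hw].
  exists (fun x => u' x * w x + u x * w' x); last by move=> x; exact: isdM.
  by apply: GenAdd; exact: GenMul.
- move=> g u /smooth1_derive[g' sg' hg] gu [u' gu' hu].
  exists (fun x => g' (u x) * u' x); last by move=> x; exact: isd_comp.
  by apply: GenMul => //; exact: GenComp.
Qed.

Lemma smooth_gen_smoothR u : smooth_gen u -> smoothR u.
Proof.
move=> gu s; have [w gw ->] : exists2 w, smooth_gen w & iter_pder s u = w.
  elim: s => [|j s [w gw IH]] /=; first by exists u.
  have [w' gw' hw] := smooth_gen_derive j gw; exists w' => //.
  by apply/funext => x; rewrite IH; have [_ ->] := hw x.
split; first exact: smooth_gen_cont.
by move=> j x; have [w' _ hw] := smooth_gen_derive j gw; have [] := hw x.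
Qed.

Lemma smooth_gen_sum (r : seq 'I_n) (P : pred 'I_n) (u : 'I_n -> 'rV[R]_n -> R) :
  (forall i, smooth_gen (u i)) -> smooth_gen (fun x => \sum_(i <- r | P i) u i x).
Proof.
move=> gu; elim: r => [|i r IH].
  rewrite (_ : (fun _ => _) = fun=> 0); first exact: GenCst.
  by apply/funext => x; rewrite big_nil.
have [Pi|Pi] := boolP (P i).
  rewrite (_ : (fun _ => _) = fun x => u i x + \sum_(i <- r | P i) u i x).
    exact: GenAdd.
  by apply/funext => x; rewrite big_cons Pi.
rewrite (_ : (fun _ => _) = fun x => \sum_(i <- r | P i) u i x) //.
by apply/funext => x; rewrite big_cons (negPf Pi).
Qed.

Lemma smooth_gen_prod (r : seq 'I_n) (P : pred 'I_n) (u : 'I_n -> 'rV[R]_n -> R) :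
  (forall i, smooth_gen (u i)) -> smooth_gen (fun x => \prod_(i <- r | P i) u i x).
Proof.
move=> gu; elim: r => [|i r IH].
  rewrite (_ : (fun _ => _) = fun=> 1); first exact: GenCst.
  by apply/funext => x; rewrite big_nil.
have [Pi|Pi] := boolP (P i).
  rewrite (_ : (fun _ => _) = fun x => u i x * \prod_(i <- r | P i) u i x).
    exact: GenMul.
  by apply/funext => x; rewrite big_cons Pi.
rewrite (_ : (fun _ => _) = fun x => \prod_(i <- r | P i) u i x) //.
by apply/funext => x; rewrite big_cons (negPf Pi).
Qed.

End smooth_space.

(** * Sharpness of the constant *)

Section trapezoid.
Variable R : realType.
Implicit Types (s t : R).

(** The ramp min(max(s, 0), 1), written with absolute values so that continuity is immediate. *)
Definition clamp s : R := (`|s| - `|s - 1| + 1) / 2.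

Lemma clamp0 s : s <= 0 -> clamp s = 0.
Proof. by move=> s0; rewrite /clamp ler0_norm// ler0_norm; lra. Qed.

Lemma clamp1 s : 1 <= s -> clamp s = 1.
Proof. by move=> s1; rewrite /clamp ger0_norm ?ger0_norm; lra. Qed.

Lemma clamp_homo s t : s <= t -> clamp s <= clamp t.
Proof.
move=> st; rewrite /clamp.
by case: (ger0P s) => ?; case: (ger0P t) => ?; case: (ger0P (s - 1)) => ?;
  case: (ger0P (t - 1)) => ?; lra.
Qed.

Lemma clamp_cont s : continuous_at s clamp.
Proof.
apply: contM; last exact: cont_cst.
apply: contD; last exact: cont_cst.
apply: contD; first exact: norm_continuous.
apply: (@cont_comp _ _ _ (fun s : R => s - 1) (fun y : R => - `|y|)).
  by apply: contD; [exact: cvg_id|exact: cont_cst].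
by apply: cvgN; exact: norm_continuous.
Qed.

(** For m >= 1 the trapezoid that rises on [0, 1], equals 1 on [1, m] and falls on [m, m + 1]; it is
    zero for m = 0. *)
Definition trap (m : nat) s : R := clamp s - clamp (s - m%:R).

Lemma trap_ge0 m s : 0 <= trap m s.
Proof. by rewrite subr_ge0; apply: clamp_homo; rewrite gerBl. Qed.

Lemma trap_le1 m s : trap m s <= 1.
Proof.
have h1 : clamp s <= 1.
  have [s1|/ltW s1] := leP 1 s; first by rewrite clamp1.
  by rewrite -(@clamp1 1)//; exact: clamp_homo.
have h2 : 0 <= clamp (s - m%:R).
  have [s1|/ltW s1] := leP (s - m%:R) 0; first by rewrite clamp0.
  by rewrite -(@clamp0 0)//; exact: clamp_homo.
by rewrite /trap; lra.
Qed.

Lemma trap_lo m s : s <= 0 -> trap m s = 0.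
Proof. by move=> s0; rewrite /trap !clamp0 ?subr0//; have := ler0n R m; lra. Qed.

Lemma trap_hi m s : m%:R + 1 <= s -> trap m s = 0.
Proof. by move=> s0; rewrite /trap !clamp1 ?subrr//; have := ler0n R m; lra. Qed.

Lemma trap_mid m s : 1 <= s -> s <= m%:R -> trap m s = 1.
Proof. by move=> s1 sm; rewrite /trap clamp1// clamp0 ?subr0//; lra. Qed.

(** The ramps telescope, so each unit of length adds one translate of [trap 1]. The factor [1] gives
    the shape of [Rn_int_profile_lin]. *)
Lemma trapS m s : trap m.+1 s = 1 * trap m s + trap 1 (s - m%:R).
Proof. by rewrite /trap -natr1 -addrA -opprD; ring. Qed.

End trapezoid.

(** * Functions of ln |x'| and their translation invariant integral *)

Section sharpness.
Variables (R : realType) (n k : nat) (p alpha : R).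
Hypotheses (k1 : (1 <= k)%N) (kn : (k <= n)%N) (p1 : 1 < p).
Implicit Types (x : 'rV[R]_n) (H G : R -> R) (s : R).

Let p0 : 0 < p. Proof. exact: lt_trans ltr01 p1. Qed.

(** The logarithm of |x'|, with the default value 0 on the axis. *)
Definition lognorm x : R := ln (sqnorm k x) / 2.
Definition cutoff x : R := \prod_(i < n | (k <= i)%N) bump (x 0 i).

(* the weight |x'|^-k dx' is dilation invariant, so that Rn_int (radial_profile H) is a
   translation invariant functional of H *)
Definition radial_profile H x : R := H (lognorm x) * expR (- (k%:R * lognorm x)) * cutoff x `^ p.

Lemma cutoff_ge0 x : 0 <= cutoff x.
Proof. by apply: prodr_ge0 => i _; exact: bump_ge0. Qed.

Lemma cutoff_out x (i : 'I_n) : (k <= i)%N -> 1 < `|x 0 i| -> cutoff x = 0.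
Proof.
move=> ki xi; rewrite /cutoff (bigD1 i)//= bump_out ?mul0r//.
by move: xi; rewrite ltr_normr => /orP[]; [right|left]; lra.
Qed.

Lemma smooth_gen_cutoff : smooth_gen cutoff.
Proof.
apply: smooth_gen_prod => i; apply: GenComp; [exact: smooth1_bump|exact: GenCoord].
Qed.

Lemma smooth_gen_sqnorm : smooth_gen (@sqnorm R k n).
Proof.
apply: smooth_gen_sum => i.
rewrite (_ : (fun _ => _) = fun x : 'rV[R]_n => x 0 i * x 0 i); last first.
  by apply/funext => x; rewrite expr2.
by apply: GenMul; exact: GenCoord.
Qed.

(** Vanishing for [s <= 0] keeps [radial_profile] zero on |x'| <= 1, and covers the default value of
    [lognorm] on the axis. *)
Definition profile H := [/\ continuous H, forall s, s <= 0 -> H s = 0 &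
  exists2 L, 0 <= L & forall s, L <= s -> H s = 0].

Lemma lognorm_le0 x : sqnorm k x <= 1 -> lognorm x <= 0.
Proof. by move=> q1; rewrite /lognorm; have := ln_le0 q1; lra. Qed.

Lemma sqnorm_coord x (i : 'I_n) : (i < k)%N -> x 0 i ^+ 2 <= sqnorm k x.
Proof.
move=> ik; rewrite /sqnorm (bigD1 i)//= lerDl.
by apply: sumr_ge0 => j _; exact: sqr_ge0.
Qed.

(** A large coordinate belongs either to [x'], and then |x'| is large, or to [x''], and then it is
    beyond the support of a bump. *)
Lemma lognorm_ge_or_cutoff0 (L : R) x i : 0 <= L -> expR L < `|x 0 i| -> L <= lognorm x \/ cutoff x = 0.
Proof.
move=> L0 xi; have [ik|ki] := ltnP i k; [left|right]; last first.
  by apply: (cutoff_out ki); apply: le_lt_trans xi; have := expR_ge1Dx L; lra.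
have q1 : expR (2 * L) <= sqnorm k x.
  apply: le_trans (sqnorm_coord x ik).
  rewrite -(real_normK (num_real (x 0 i))) mulr_natl mulr2n expRD -expr2.
  by rewrite ler_pXn2r ?nnegrE ?expR_ge0// ltW.
have : ln (expR (2 * L)) <= ln (sqnorm k x).
  by rewrite ler_ln ?posrE ?expR_gt0//; exact: lt_le_trans (expR_gt0 _) q1.
by rewrite expRK /lognorm; lra.
Qed.

Lemma cc_radial_profile H : profile H -> cc (radial_profile H).
Proof.
move=> [cH H0 [L L0 HL]]; split.
  move=> x; have [q1|q1] := ltP (sqnorm k x) 1.
    apply: (@cont_near _ _ _ (fun=> 0)); first exact: cont_cst.
    have : \forall y \near x, sqnorm k y < 1.
      exact: (cvgr_lt _ (@cont_sqnorm R k n x)).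
    by apply: filterS => y /ltW/lognorm_le0 h; rewrite /radial_profile H0// !mul0r.
  have q0 : 0 < sqnorm k x by lra.
  have csg : continuous_at x lognorm.
    apply: contM; last exact: cont_cst.
    apply: (@cont_comp _ _ _ (@sqnorm R k n) (@ln R)); first exact: cont_sqnorm.
    exact: continuous_ln.
  apply: contM; first apply: contM.
  - apply: (@cont_comp _ _ _ lognorm H) => //; exact: cH.
  - apply: (@cont_comp _ _ _ lognorm (fun s => expR (- (k%:R * s)))) => //.
    apply: (@cont_comp _ _ _ (fun s : R => - (k%:R * s)) expR); last exact: continuous_expR.
    apply: (@cont_comp _ _ _ (fun s : R => k%:R * s) (fun s : R => - s)).
      by apply: contM; [exact: cont_cst|exact: cvg_id].
    exact: opp_continuous.
  - apply: (@cont_ext _ _ _ (fun y => `|cutoff y| `^ p)).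
      by move=> y; rewrite ger0_norm// cutoff_ge0.
    apply: (@cont_comp _ _ _ cutoff (fun y : R => `|y| `^ p)); last exact: powR_abs_cont.
    exact: smooth_gen_cont smooth_gen_cutoff x.
exists (expR L); first exact: expR_ge0.
move=> x [i /(lognorm_ge_or_cutoff0 L0)[/HL h|h]]; rewrite /radial_profile h ?mul0r//.
by rewrite powR0 ?mulr0// gt_eqF.
Qed.

Lemma Rn_int_profile_lin (a : R) H G : profile H -> profile G ->
  Rn_int (radial_profile (fun s => a * H s + G s)) = a * Rn_int (radial_profile H) + Rn_int (radial_profile G).
Proof.
move=> pH pG; rewrite -Rn_int_lin; [|exact: cc_radial_profile|exact: cc_radial_profile].
by congr Rn_int; apply/funext => x; rewrite /radial_profile; ring.
Qed.

Lemma profile_lin (a : R) H G : profile H -> profile G -> profile (fun s => a * H s + G s).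
Proof.
move=> [cH H0 [L L0 HL]] [cG G0 [L' L'0 GL]]; split.
- move=> s; apply: contD; last exact: cG.
  by apply: contM; [exact: cont_cst|exact: cH].
- by move=> s s0; rewrite H0// G0// mulr0 addr0.
- exists (Num.max L L'); first by rewrite le_max L0.
  by move=> s; rewrite ge_max => /andP[h1 h2]; rewrite HL// GL// mulr0 addr0.
Qed.

Lemma Rn_int_profile_le H G : profile H -> profile G -> (forall s, H s <= G s) ->
  Rn_int (radial_profile H) <= Rn_int (radial_profile G).
Proof.
move=> pH pG HG; apply: Rn_int_le; [exact: cc_radial_profile|exact: cc_radial_profile|move=> x].
by rewrite /radial_profile -!mulrA ler_wpM2r// mulr_ge0 ?expR_ge0 ?powR_ge0.
Qed.

Lemma profile_shift H (t : R) : 0 <= t -> profile H -> profile (fun s => H (s - t)).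
Proof.
move=> t0 [cH H0 [L L0 HL]]; split.
- move=> s; apply: (@cont_comp _ _ _ (fun s : R => s - t) H); last exact: cH.
  by apply: contD; [exact: cvg_id|exact: cont_cst].
- by move=> s s0; apply: H0; lra.
- by exists (L + t); [lra|move=> s h; apply: HL; lra].
Qed.

(** Dilating [x'] by e^(-t) subtracts [t] from [lognorm]; the Jacobian e^(-kt) is cancelled by the
    factor |x'|^(-k). *)
Lemma Rn_int_profile_shift H (t : R) : 0 <= t -> profile H ->
  Rn_int (radial_profile (fun s => H (s - t))) = Rn_int (radial_profile H).
Proof.
move=> t0 pH; have [cH H0 _] := pH.
pose c (i : nat) : R := if (i < k)%N then expR (- t) else 1.
have c0 i : 0 < c i by rewrite /c; case: ifP => // _; exact: expR_gt0.
have := Rn_int_dil (cc_radial_profile pH) c0.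
have -> : \prod_(i < n) c i = expR (- (k%:R * t)).
  rewrite /c -big_mkcond /= (big_ord_narrow kn) prodr_const card_ord.
  by rewrite -expRM_natl mulrN.
have -> : (fun x => radial_profile H (dil c x)) =
    (fun x => expR (k%:R * t) * radial_profile (fun s => H (s - t)) x).
  apply/funext => x.
  have qE : sqnorm k (dil c x) = expR (- (2 * t)) * sqnorm k x.
    rewrite /sqnorm mulr_sumr; apply: eq_bigr => i ik.
    rewrite mxE /c ik exprMn; congr (_ * _).
    by rewrite expr2 -expRD; congr expR; ring.
  have BE : cutoff (dil c x) = cutoff x.
    by apply: eq_bigr => i ki; rewrite mxE /c ltnNge ki /= mul1r.
  (* On the axis [lognorm] keeps its default value and is not shifted; both sides vanish because [H]
     is zero at 0 and at [- t]. *)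
  rewrite /radial_profile BE; have [q0|q0] := eqVneq (sqnorm k x) 0.
    by rewrite /lognorm qE q0 mulr0 ln0// mul0r !H0 ?sub0r ?oppr_le0// !mul0r mulr0.
  have {}q0 : 0 < sqnorm k x by rewrite lt_neqAle eq_sym q0 sqnorm_ge0.
  have -> : lognorm (dil c x) = lognorm x - t.
    by rewrite /lognorm qE lnM ?posrE ?expR_gt0// expRK; lra.
  have -> : expR (- (k%:R * (lognorm x - t))) = expR (k%:R * t) * expR (- (k%:R * lognorm x)).
    by rewrite -expRD; congr expR; ring.
  by ring.
rewrite Rn_intZ; last exact/cc_radial_profile/profile_shift.
rewrite -expRN opprK => h.
by apply: (mulfI (lt0r_neq0 (expR_gt0 (k%:R * t)))).
Qed.

Lemma profile_trap m : profile (@trap R m).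
Proof.
split.
- move=> s; apply: contD; first exact: clamp_cont.
  apply: (@cont_comp _ _ _ (fun s : R => clamp (s - m%:R)) (fun y : R => - y)); last exact: opp_continuous.
  apply: (@cont_comp _ _ _ (fun s : R => s - m%:R) (@clamp R)); last exact: clamp_cont.
  by apply: contD; [exact: cvg_id|exact: cont_cst].
- by move=> s; exact: trap_lo.
- by exists (m%:R + 1); [rewrite addr_ge0|move=> s; exact: trap_hi].
Qed.

Lemma Rn_int_profile_trap m : Rn_int (radial_profile (@trap R m)) = m%:R * Rn_int (radial_profile (@trap R 1)).
Proof.
elim: m => [|m IH].
  rewrite mul0r -(Rn_int0 R n); congr Rn_int; apply/funext => x.
  by rewrite /radial_profile /trap subr0 subrr !mul0r.
have -> : @trap R m.+1 = (fun s => 1 * trap m s + trap 1 (s - m%:R)).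
  by apply/funext => s; exact: trapS.
rewrite Rn_int_profile_lin; [|exact: profile_trap|exact/profile_shift/profile_trap].
rewrite Rn_int_profile_shift//; last exact: profile_trap.
by rewrite IH -natr1; ring.
Qed.

Lemma Rn_int_profile_trap1_gt0 : 0 < Rn_int (radial_profile (@trap R 1)).
Proof.
have n0 : (0 < n)%N by exact: leq_trans kn.
pose i0 := Ordinal n0.
(* Here |x'| = e, so [lognorm] is 1, the peak of [trap 1]; the coordinates of [x''] sit in the
   middle of their bumps. *)
pose x0 : 'rV[R]_n := \row_i (if i == i0 then expR 1 else if (i < k)%N then 0 else 1 / 2).
apply: (@Rn_int_gt0 _ _ _ x0); first exact/cc_radial_profile/profile_trap.
  by move=> x; rewrite /radial_profile !mulr_ge0 ?expR_ge0 ?powR_ge0 ?trap_ge0.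
have qE : sqnorm k x0 = expR 1 ^+ 2.
  rewrite /sqnorm (bigD1 i0)//= mxE eqxx big1 ?addr0// => i /andP[ik ii0].
  by rewrite mxE (negPf ii0) ik expr0n.
have sE : lognorm x0 = 1 by rewrite /lognorm qE -expRM_natl expRK; lra.
rewrite /radial_profile sE trap_mid// mul1r mulr_gt0 ?expR_gt0// powR_gt0//.
apply: prodr_gt0 => i ki; rewrite mxE ifF; last first.
  by apply/eqP => ii0; move: ki; rewrite ii0 /= leqNgt k1.
rewrite ltnNge ki /=; apply: lt_le_trans (expR_gt0 (- 6)) (bump_mid _).
by apply/andP; split; lra.
Qed.

Let a : R := (k%:R - alpha) / p.
Let c : R := `|a| `^ p.

(** Because [a * p = k - alpha], the powers of |x'| collapse to the dilation invariant |x'|^(-k). *)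
Lemma radial_profileE x (Y : R -> R) : (sqnorm k x = 0 -> Y (lognorm x) = 0) ->
  `|expR (- a * lognorm x) * Y (lognorm x) * cutoff x| `^ p * sqnorm k x `^ (- (alpha / 2)) =
  radial_profile (fun s => `|Y s| `^ p) x.
Proof.
rewrite /radial_profile => Y0; have [q0|q0] := eqVneq (sqnorm k x) 0.
  by rewrite Y0// mulr0 mul0r normr0 powR0 ?mul0r// gt_eqF.
have {}q0 : 0 < sqnorm k x by rewrite lt_neqAle eq_sym q0 sqnorm_ge0.
rewrite !normrM (ger0_norm (expR_ge0 _)) (ger0_norm (cutoff_ge0 _)).
rewrite !powRM ?mulr_ge0 ?expR_ge0 ?cutoff_ge0// -expRM.
have -> : sqnorm k x `^ (- (alpha / 2)) = expR (- (alpha * lognorm x)).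
  by rewrite /powR gt_eqF// /lognorm; congr expR; ring.
have -> : expR (- (k%:R * lognorm x)) = expR (- a * lognorm x * p) * expR (- (alpha * lognorm x)).
  by rewrite -expRD; congr expR; rewrite /a; field; rewrite gt_eqF.
ring.
Qed.

(** If d <= th A, the first term alone dominates; otherwise A < d / th and the second does. The
    factor of A^p can thus be as close to 1 as desired. *)
Lemma powR_split_le (A d th : R) : 0 <= A -> 0 <= d -> 0 < th ->
  (A + d) `^ p <= (1 + th) `^ p * A `^ p + (d * (1 + th^-1)) `^ p.
Proof.
move=> A0 d0 th0; have thV : 0 < th^-1 by rewrite invr_gt0.
have pw := ge0_ler_powR (ltW p0).
have [dA|dA] := leP d (th * A).
  have : (A + d) `^ p <= ((1 + th) * A) `^ p.
    by apply: pw; rewrite ?nnegrE ?addr_ge0 ?mulr_ge0//; lra.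
  by rewrite powRM//; [have := powR_ge0 (d * (1 + th^-1)) p; lra|lra].
have h : A <= d * th^-1 by rewrite ler_pdivlMr// mulrC ltW.
have : (A + d) `^ p <= (d * (1 + th^-1)) `^ p.
  by apply: pw; rewrite ?nnegrE ?addr_ge0 ?mulr_ge0//; lra.
have : 0 <= (1 + th) `^ p * A `^ p by rewrite mulr_ge0 ?powR_ge0.
by lra.
Qed.

Lemma profile_powR (Y : R -> R) (L : R) : continuous Y -> 0 <= L ->
  (forall s, s < 1 \/ L < s -> Y s = 0) -> profile (fun s => `|Y s| `^ p).
Proof.
move=> cY L0 Y0; split.
- move=> s; apply: (@cont_comp _ _ _ Y (fun y : R => `|y| `^ p)); first exact: cY.
  exact: powR_abs_cont.
- by move=> s s0; rewrite Y0 ?normr0 ?powR0 ?gt_eqF//; left; lra.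
- exists (L + 1); first by lra.
  by move=> s s0; rewrite Y0 ?normr0 ?powR0 ?gt_eqF//; right; lra.
Qed.

Lemma isd_cutoff (j : 'I_n) x : (j < k)%N -> is_derive x 'e_j cutoff 0.
Proof.
move=> jk; rewrite -[x]addr0 -(scale0r 'e_j); apply/is_derive_line.
rewrite (_ : (fun _ => _) = cst (cutoff x)); first exact: is_derive_cst.
apply/funext => h; apply: eq_bigr => i ki; rewrite !mxE.
have /negPf -> : i != j by apply/eqP => ij; move: ki; rewrite ij leqNgt jk.
by rewrite andbF mulr0 addr0.
Qed.

(** * The stretched test function and its two integrals *)

Section test_function.
Variables (b' : R -> R) (kap : R).
Hypotheses (sb' : smooth1 b') (hb : forall t, is_derive t (1 : R) (@bump R) (b' t)).
Hypotheses (b'0 : forall t, t < 0 \/ 1 < t -> b' t = 0) (kap0 : 0 < kap).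

(** [X] lives on [1, 1 + 1/kap], starting at 1 to stay clear of [s <= 0]. The derivative of e^(-as)
    X(s) is e^(-as) Y(s). *)
Let X s : R := bump (kap * s - kap).
Let X' s : R := b' (kap * s - kap) * kap.
Let Y s : R := - a * X s + X' s.
Let L : R := 1 + kap^-1.

Lemma stretched_out s : s < 1 \/ L < s -> X s = 0 /\ X' s = 0.
Proof.
move=> h; have {}h : kap * s - kap < 0 \/ 1 < kap * s - kap.
  have kapV : kap * kap^-1 = 1 by rewrite divff ?gt_eqF.
  case: h => h; [left|right]; first by rewrite subr_lt0 gtr_pMr.
  have : kap * L < kap * s by rewrite ltr_pM2l.
  by rewrite /L mulrDr mulr1 kapV ltrBrDr addrC.
split; last by rewrite /X' b'0 ?mul0r.
by apply: bump_out; case: h => /ltW; [left|right].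
Qed.

Let L0 : 0 <= L. Proof. by rewrite addr_ge0// invr_ge0 ltW. Qed.

Lemma stretched_cont (g : R -> R) : smooth1 g -> continuous (fun s => g (kap * s - kap)).
Proof. by move=> sg0; apply: smooth1_cont; exact: smooth1_aff. Qed.

Lemma profile_X : profile (fun s => `|X s| `^ p).
Proof.
apply: (@profile_powR _ L) => //.
  by apply: stretched_cont; exact: smooth1_bump.
by move=> s /stretched_out[].
Qed.

Lemma profile_Y : profile (fun s => `|Y s| `^ p).
Proof.
apply: (@profile_powR _ L) => //.
  move=> s; apply: contD.
    apply: contM; first exact: cont_cst.
    by apply: stretched_cont; exact: smooth1_bump.
  by apply: contM; [exact: stretched_cont|exact: cont_cst].
by move=> s /stretched_out[h1 h2]; rewrite /Y h1 h2 mulr0 addr0.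
Qed.

(** The function e^(-as) X(s) in the variable ln |x'|^2 = 2s, whence the halved constants; [+ 0] and
    [+ - kap] give the shape of [smooth1_aff]. *)
Let g s : R := expR (- (a / 2) * s + 0) * bump (kap / 2 * s + - kap).
Let g' s : R := expR (- (a / 2) * s + 0) * - (a / 2) * bump (kap / 2 * s + - kap)
  + expR (- (a / 2) * s + 0) * (b' (kap / 2 * s + - kap) * (kap / 2)).
Let u x : R := g (ln (sqnorm k x)) * cutoff x.

Lemma isd_g s : is_derive s (1 : R) g (g' s).
Proof.
apply: isdM; first exact: isd_comp (isd_aff _ _ s) (is_derive_expR _).
exact: isd_comp (isd_aff _ _ s) (hb _).
Qed.

Lemma vanish_g : vanish_near0 g.
Proof.
exists 2 => // s s2; rewrite /g bump_out ?mulr0//; left.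
rewrite subr_le0 -mulrA ger_pMr//; lra.
Qed.

Lemma smooth_gen_test_u : smooth_gen u.
Proof.
apply: GenMul; last exact: smooth_gen_cutoff.
apply: (@GenComp _ _ (fun r => g (ln r))); last exact: smooth_gen_sqnorm.
apply: smooth1_comp_ln; last exact: vanish_g.
apply: smooth1_mul; apply: smooth1_aff; [exact: smooth1_expR|exact: smooth1_bump].
Qed.

Lemma test_uE x : u x = expR (- a * lognorm x) * X (lognorm x) * cutoff x.
Proof.
rewrite /u /g /X /lognorm; by congr (expR _ * bump _ * _); field.
Qed.

Lemma stretched_axis x : sqnorm k x = 0 -> X (lognorm x) = 0 /\ Y (lognorm x) = 0.
Proof.
move=> q0; have [h1 h2] : X (lognorm x) = 0 /\ X' (lognorm x) = 0.
  by apply: stretched_out; left; rewrite /lognorm q0 ln0// mul0r.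
by rewrite /Y h1 h2 mulr0 addr0.
Qed.

Let f x : R[i] := Complex (u x) 0.

Lemma test_fun_f : test_fun k f.
Proof.
split.
  split; first exact: smooth_gen_smoothR smooth_gen_test_u.
  exact: smooth_gen_smoothR (@GenCst R n 0).
exists ([set x : 'rV[R]_n | forall i, `[- expR L, expR L]%classic (x 0 i)] `&`
  (@sqnorm R k n) @^-1` [set y | 1 <= y]); split.
- apply: compact_closedI.
    by apply: (@rV_compact _ _ (fun=> `[- expR L, expR L]%classic)) => _; exact: segment_compact.
  by apply: closed_comp; [move=> x _; exact: cont_sqnorm|exact: closed_ge].
- by move=> x [_ /= q1]; rewrite xnorm_eq0 gt_eqF//; lra.
- move=> x /not_andP; rewrite /f => h0; suff -> : u x = 0 by [].
  case: h0 => [/existsNP[i xi]|/negP].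
    have {}xi : expR L < `|x 0 i|.
      by rewrite ltNge; apply/negP => xi0; apply: xi; rewrite /= in_itv/= -ler_norml.
    rewrite test_uE; have [Ls|->] := lognorm_ge_or_cutoff0 L0 xi; last by rewrite mulr0.
    (* The endpoint [L] escapes the strict inequality of [stretched_out]; there the bump is
       evaluated at 1. *)
    move: Ls; rewrite le_eqVlt => /predU1P[Ls|Ls].
      have kL : kap * L - kap = 1 by rewrite /L; field; rewrite gt_eqF.
      by rewrite /X -Ls kL bump_out ?mulr0 ?mul0r//; right.
    by have [-> _] := stretched_out (or_intror Ls); rewrite mulr0 mul0r.
  rewrite -ltNge => /ltW/lognorm_le0 s0; rewrite test_uE.
  have [-> _] : X (lognorm x) = 0 /\ X' (lognorm x) = 0 by apply: stretched_out; left; lra.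
  by rewrite mulr0 mul0r.
Qed.

Lemma cabs_real (r : R) : cabs (Complex r 0) = `|r|.
Proof. by rewrite /cabs /= expr0n /= addr0 sqrtr_sqr. Qed.

Lemma lhs_f : integral_Rn (fun x => (cabs (f x) `^ p / xnorm k x `^ alpha)%:E) =
  (Rn_int (radial_profile (fun s => `|X s| `^ p)))%:E.
Proof.
rewrite -integral_RnE; last exact/cc_radial_profile/profile_X.
congr integral_Rn; apply/funext => x; congr EFin.
rewrite /f cabs_real xnorm_powRV test_uE radial_profileE// => /stretched_axis[].
by [].
Qed.

(** As the sum of [x 0 j * (2 * x 0 j)] over [x'] is twice [sqnorm], the radial derivative acts as
    d/ds on functions of s = ln |x'|, and [cutoff] is constant for it. *)
Lemma radial_f x : radial_der k f x =
  Complex (expR (- a * lognorm x) * Y (lognorm x) * cutoff x) 0.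
Proof.
rewrite radial_derE; congr Complex; last first.
  by apply: big1 => j _; rewrite [X in _ * X](derive_cst (0 : R) x 'e_j) mulr0.
rewrite /radial_re.
have Du (j : 'I_n) : (j < k)%N -> 'D_'e_j u x =
    g' (ln (sqnorm k x)) * expR (- ln (sqnorm k x)) * (2 * x 0 j) * cutoff x.
  move=> jk.
  have h1 := isd_comp (isd_sqnorm x jk) (isd_comp_ln (sqnorm k x) isd_g vanish_g).
  have [_ ->] := isdM h1 (isd_cutoff x jk).
  by rewrite mulr0 addr0.
rewrite (eq_bigr (fun j => (2 * g' (ln (sqnorm k x)) * expR (- ln (sqnorm k x)) * cutoff x) * x 0 j ^+ 2)).
  rewrite -mulr_sumr -/(sqnorm k x).
  have [q0|q0] := eqVneq (sqnorm k x) 0.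
    by rewrite q0 mulr0; have [_ ->] := stretched_axis q0; rewrite mulr0 mul0r.
  have {}q0 : 0 < sqnorm k x by rewrite lt_neqAle eq_sym q0 sqnorm_ge0.
  rewrite expRN lnK ?posrE// /g' /Y /X /X'.
  have -> : - (a / 2) * ln (sqnorm k x) + 0 = - a * lognorm x by rewrite /lognorm; field.
  have -> : kap / 2 * ln (sqnorm k x) + - kap = kap * lognorm x - kap by rewrite /lognorm; field.
  by field; rewrite gt_eqF.
by move=> j jk; rewrite Du//; ring.
Qed.

Lemma rhs_f :
  integral_Rn (fun x => (cabs (radial_der k f x) `^ p / xnorm k x `^ alpha)%:E) =
  (Rn_int (radial_profile (fun s => `|Y s| `^ p)))%:E.
Proof.
rewrite -integral_RnE; last exact/cc_radial_profile/profile_Y.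
congr integral_Rn; apply/funext => x; congr EFin.
rewrite radial_f cabs_real xnorm_powRV radial_profileE// => /stretched_axis[].
by [].
Qed.

End test_function.

(** X' is of order [kap] on an interval of length 1/kap, so the integral of its p-th power stays
    bounded while that of |X|^p grows like 1/kap. *)
Lemma hardy_sharp (C : R) : alpha != k%:R -> c < C ->
  exists f : 'rV[R]_n -> R[i], test_fun k f /\
    (integral_Rn (fun x => (cabs (radial_der k f x) `^ p / xnorm k x `^ alpha)%:E)
     < C%:E * integral_Rn (fun x => (cabs (f x) `^ p / xnorm k x `^ alpha)%:E))%E.
Proof.
move=> ak cC.
have a0 : a != 0 by rewrite /a mulf_eq0 invr_eq0 (gt_eqF p0) orbF subr_eq0 eq_sym.
have c0 : 0 < c by rewrite powR_gt0// normr_gt0.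
(* The gap from [c] to [C] is shared: raising [c] to [C'] pays for splitting the p-th power, which
   fixes [th], and [C - C'] pays for the contribution of X'. *)
pose C' := (C + c) / 2.
have cC' : c < C' by rewrite /C'; lra.
have C'C : C' < C by rewrite /C'; lra.
pose th := (C' / c) `^ p^-1 - 1.
have r1 : 1 < C' / c by rewrite ltr_pdivlMr// mul1r.
have pV : 0 < p^-1 by rewrite invr_gt0.
have th0 : 0 < th.
  have := gt0_ltr_powR pV; move=> /(_ 1 (C' / c)); rewrite !nnegrE ler01 powR1.
  by move=> /(_ isT) h; rewrite subr_gt0 h//; lra.
have thp : (1 + th) `^ p * c = C'.
  rewrite /th addrC subrK -powRrM mulVf ?gt_eqF// powRr1; last by lra.
  by rewrite divfK// gt_eqF.
have [b' sb' [hb b'0 [M M0 hM]]] := @bump_derive R.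
have thV : 0 < th^-1 by rewrite invr_gt0.
(* [M * kap] bounds |X'| and the splitting multiplies it by [1 + th^-1], so the pointwise error is
   (E kap)^p. *)
pose E := M * (1 + th^-1).
have E0 : 0 <= E by rewrite mulr_ge0//; lra.
pose mu := (expR (- 6) : R) `^ p.
have mu0 : 0 < mu by rewrite powR_gt0// expR_gt0.
have q0 : 0 < (C - C') * mu by rewrite mulr_gt0// subr_gt0.
(* The first summand will give [E * kap <= 1]; the second makes the growth [(C - C') * mu * m]
   exceed the error [2 * E]. *)
pose T := E + (2 * E) / ((C - C') * mu).
have T2 : 0 <= (2 * E) / ((C - C') * mu).
  by apply: divr_ge0; [rewrite mulr_ge0|exact: ltW].
have T0 : 0 <= T by rewrite addr_ge0.
have [m mT] : exists m : nat, T < m%:R by exists (Num.bound T); exact: archi_boundP.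
have mE : E <= m%:R by rewrite /T in mT; lra.
have m2E : 2 * E < (C - C') * mu * m%:R.
  have : (2 * E) / ((C - C') * mu) < m%:R by rewrite /T in mT; lra.
  by rewrite ltr_pdivrMr// [ltRHS]mulrC.
(* The support of [trap m] has length N = m + 1; stretching the bump to 3N lets its middle third
   contain a translate. *)
pose N : R := m%:R + 1.
have m0 : 0 <= m%:R :> R by [].
have N0 : 0 < N by rewrite /N; lra.
pose kap := (3 * N)^-1.
have kap0 : 0 < kap by rewrite invr_gt0; lra.
have kapN : kap * (3 * N) = 1 by rewrite mulVf// gt_eqF//; lra.
have kapV : kap^-1 = 3 * N by rewrite invrK.
pose X s : R := bump (kap * s - kap).
pose X' s : R := b' (kap * s - kap) * kap.
pose Y s : R := - a * X s + X' s.
exists (fun x => Complex (expR (- (a / 2) * ln (sqnorm k x) + 0) *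
   bump (kap / 2 * ln (sqnorm k x) + - kap) * cutoff x) 0).
split; first exact: (test_fun_f b'0).
rewrite (lhs_f b'0)// (rhs_f sb' hb b'0)// -EFinM lte_fin.
have pX : profile (fun s => `|X s| `^ p) by exact: (profile_X b'0).
have pY : profile (fun s => `|Y s| `^ p) by exact: (profile_Y sb' b'0).
rewrite -/X -/X' -/Y.
pose J := Rn_int (radial_profile (@trap R 1)).
have J0 : 0 < J by exact: Rn_int_profile_trap1_gt0.
pose LL := Rn_int (radial_profile (fun s => `|X s| `^ p)).
have X01 s : 0 <= X s by exact: bump_ge0.
(* The trapezoid moved by [N + 1] lives on [N + 1, 2N + 1], where [kap * s - kap] runs over
   [1/3, 2/3]. *)
have low : mu * (m%:R * J) <= LL.
  have N1 : 0 <= N + 1 by lra.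
  have pT := profile_shift N1 (profile_trap m).
  (* The multiple [mu * H] is written as [(mu - 1) * H + H] to fit the linearity rule. *)
  have := Rn_int_profile_le (profile_lin (mu - 1) pT pT) pX.
  rewrite (Rn_int_profile_lin (mu - 1) pT pT) (Rn_int_profile_shift N1 (profile_trap m)) Rn_int_profile_trap.
  rewrite -/J -/LL => h; suff : (mu - 1) * (m%:R * J) + m%:R * J <= LL by lra.
  apply: h => s; have -> : (mu - 1) * trap m (s - (N + 1)) + trap m (s - (N + 1)) =
    mu * trap m (s - (N + 1)) by ring.
  have [s1|s1] := leP (s - (N + 1)) 0; first by rewrite trap_lo// mulr0 powR_ge0.
  have [s2|s2] := leP (m%:R + 1) (s - (N + 1)).
    by rewrite trap_hi// mulr0 powR_ge0.
  apply: (@le_trans _ _ mu); first by rewrite ler_piMr ?trap_le1// ltW.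
  apply: (ge0_ler_powR (ltW p0)); rewrite ?nnegrE ?expR_ge0//.
  rewrite ger0_norm//; apply: bump_mid.
  have h1 : kap * N <= kap * (s - 1) by rewrite ler_pM2l//; lra.
  have h2 : kap * (s - 1) <= kap * (2 * N).
    by rewrite ler_pM2l//; rewrite -/N in s2; lra.
  by apply/andP; split; lra.
(* As a real number [tn] is 3N + 1, so [trap tn] equals 1 on [1, 3N + 1], the interval that carries
   [Y]. *)
pose tn := (3 * m.+1).+1.
have tnE : tn%:R = 3 * N + 1 by rewrite /tn -(natr1 (3 * m.+1)) natrM -(natr1 m).
pose D := (E * kap) `^ p.
have up : Rn_int (radial_profile (fun s => `|Y s| `^ p)) <= D * (tn%:R * J) + C' * LL.
  have pT := profile_trap tn.
  have pX2 := profile_lin (C' - 1) pX pX.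
  have := Rn_int_profile_le pY (profile_lin D pT pX2).
  rewrite (Rn_int_profile_lin D pT pX2) (Rn_int_profile_lin (C' - 1) pX pX) Rn_int_profile_trap -/J -/LL => h.
  suff : Rn_int (radial_profile (fun s => `|Y s| `^ p)) <= D * (tn%:R * J) + ((C' - 1) * LL + LL) by lra.
  apply: h => s.
  have -> : D * trap tn s + ((C' - 1) * `|X s| `^ p + `|X s| `^ p) =
    D * trap tn s + C' * `|X s| `^ p by ring.
  have D0 : 0 <= D by exact: powR_ge0.
  have [s12|] := boolP ((1 <= s) && (s <= 3 * N + 1)); last first.
    rewrite negb_and -!ltNge => sout.
    have [X0 X'0] : X s = 0 /\ X' s = 0.
      apply: (stretched_out b'0) => //; rewrite kapV.
      by case/orP: sout => h1; [left|right; rewrite addrC].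
    rewrite /Y X0 X'0 mulr0 addr0 normr0 powR0 ?gt_eqF// mulr0 addr0.
    by rewrite mulr_ge0// trap_ge0.
  have /andP[s1 s2] := s12.
  rewrite trap_mid ?tnE// mulr1.
  have XY : `|Y s| <= `|a| * `|X s| + M * kap.
    apply: le_trans (ler_normD _ _) _; rewrite normrM normrN lerD2l normrM.
    by rewrite (gtr0_norm kap0) ler_pM2r.
  have AX : 0 <= `|a| * `|X s| by rewrite mulr_ge0.
  have Mk : 0 <= M * kap by rewrite mulr_ge0// ltW.
  have h1 : `|Y s| `^ p <= (`|a| * `|X s| + M * kap) `^ p.
    by apply: (ge0_ler_powR (ltW p0)); rewrite ?nnegrE// addr_ge0.
  have := powR_split_le AX Mk th0.
  rewrite (powRM p (normr_ge0 a) (normr_ge0 (X s))) -/c mulrA thp.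
  have -> : M * kap * (1 + th^-1) = E * kap by rewrite /E; ring.
  by rewrite -/D; lra.
have kapE : E * kap <= 1.
  by rewrite -kapN mulrC ler_pM2l//; rewrite /N; lra.
have kap1 : kap <= 1.
  by rewrite -[leRHS]kapN ler_peMr ?ltW//; rewrite /N; lra.
have DE : D <= E * kap.
  have : 0 <= E * kap by rewrite mulr_ge0// ltW.
  rewrite le_eqVlt => /predU1P[e0|e0].
    by rewrite /D -e0 powR0// gt_eqF.
  by apply: ge1r_powR; rewrite ?e0//; exact: ltW.
have tnJ : D * (tn%:R * J) <= 2 * E * J.
  rewrite mulrA ler_pM2r// tnE.
  apply: (@le_trans _ _ (E * kap * (3 * N + 1))); first by rewrite ler_wpM2r//; lra.
  have -> : E * kap * (3 * N + 1) = E * (kap * (3 * N)) + E * kap by ring.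
  have : E * kap <= E * 1 by rewrite ler_wpM2l.
  by rewrite kapN; lra.
have h1 : 2 * E * J < (C - C') * mu * m%:R * J by rewrite ltr_pM2r.
have h2 : (C - C') * (mu * (m%:R * J)) <= (C - C') * LL.
  by rewrite ler_wpM2l//; lra.
have h3 : (C - C') * (mu * (m%:R * J)) = (C - C') * mu * m%:R * J by ring.
by rewrite -/LL; lra.
Qed.

End sharpness.

Theorem theorem3p1 (R : realType) (n k : nat) (p alpha : R) :
  (1 <= k)%N -> (k <= n)%N -> 1 < p ->
  let a : R := (k%:R - alpha) / p in
  let c : R := `|a| `^ p in
  let lhs := fun f : 'rV[R]_n -> R[i] =>
    integral_Rn (fun x => (cabs (f x) `^ p / xnorm k x `^ alpha)%:E) in
  let rhs := fun f : 'rV[R]_n -> R[i] =>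
    integral_Rn (fun x => (cabs (radial_der k f x) `^ p / xnorm k x `^ alpha)%:E) in
  let wf := fun (f : 'rV[R]_n -> R[i]) (x : 'rV[R]_n) =>
    f x / Complex (xnorm k x `^ (alpha / p)) 0 in
  let wg := fun (f : 'rV[R]_n -> R[i]) (x : 'rV[R]_n) =>
    radial_der k f x / Complex (xnorm k x `^ (alpha / p)) 0 in
  let Cint := fun f : 'rV[R]_n -> R[i] =>
    integral_Rn (fun x => (Cp p (wg f x) (wg f x + Complex a 0 * wf f x))%:E) in
  [/\ (* (i) Hardy-type inequality *)
      (forall f, test_fun k f -> (c%:E * lhs f <= rhs f)%E),
      (* (i) sharpness of the constant when alpha <> k *)
      (alpha != k%:R -> forall C : R, c < C ->
         exists f, test_fun k f /\ (rhs f < C%:E * lhs f)%E),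
      (* (ii) identity with remainder *)
      (forall f, test_fun k f ->
         (c%:E * integral_Rn (fun x => (cabs (wf f x) `^ p)%:E)
          = integral_Rn (fun x => (cabs (wg f x) `^ p)%:E) - Cint f)%E)
    & (* (iii) strict positivity of the remainder for p >= 2,
         hence strict inequality (non-attainment) *)
      (2 <= p -> forall f, test_fun k f -> (exists x, f x != 0) ->
         (0 < Cint f)%E /\ (c%:E * lhs f < rhs f)%E)].
Proof.
move=> k1 kn p1 a c lhs rhs wf wg Cint.
have H := fun f => @hardy_integrals R k n p alpha kn p1 f.
split=> [f /H[L [G [lE gE _ _ [_ LG _]]]]|ak C|f /H[L [G [_ _ lE gE [CE _ _]]]]|_ f /H[L [G [lE gE _ _ [CE _ LG]]]] f0].
- by rewrite /lhs /rhs lE gE -EFinM lee_fin -subr_ge0.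
- exact: hardy_sharp.
- by rewrite /Cint CE lE gE -/a -/c -EFinM -EFinB; congr EFin; ring.
- rewrite /Cint /lhs /rhs CE lE gE -EFinM !lte_fin.
  by have h := LG f0; split; [exact: h|rewrite -subr_gt0].
Qed.
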